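(* Let $0<\alpha\le1$ and $$s_\alpha=\begin{cases}-3/4, & 0<\alpha\le 1/2,\\ -3/(5-2\alpha), & 1/2<\alpha\le 1.\end{cases}$$ If $s\le s_\alpha$, then for any $0<\delta\ll1$ (i.e. for every sufficiently small $\delta>0$) there does not exist a constant $C>0$ such that for all $u,v\in\mathcal{S}(\mathbb{R}^2)$, $$\|\partial_x(uv)\|_{X^{-1/2+\delta,s,\alpha}}\le C\|u\|_{X^{1/2,s,\alpha}}\|v\|_{X^{1/2,s,\alpha}}.$$
   Context: $\mathcal{S}(\mathbb{R}^2)$ is the Schwartz space of functions of $(x,t)$. With $\widehat u(\xi,\tau)=\int_{\mathbb{R}^2}e^{-ix\xi}e^{-it\tau}u(x,t)\,dx\,dt$ and $\langle z\rangle=(1+|z|^2)^{1/2}$ for $z\in\mathbb{C}$, $$\|u\|_{X^{b,s,\alpha}}=\big\|\langle i(\tau-\xi^3)+|\xi|^{2\alpha}\rangle^b\langle\xi\rangle^s\widehat u(\xi,\tau)\big\|_{L^2(\mathbb{R}^2)}.$$ *)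

(* Defs.v *)
From HB Require Import structures.
From mathcomp Require Import all_boot all_order all_algebra.
From mathcomp Require Import all_classical all_reals all_analysis.
From mathcomp.real_closed Require Import complex.

Set Implicit Arguments.
Unset Strict Implicit.
Unset Printing Implicit Defensive.

Import Order.TTheory GRing.Theory Num.Theory.
Import numFieldNormedType.Exports.

Local Open Scope classical_set_scope.
Local Open Scope ring_scope.
Local Open Scope complex_scope.

(* Points of the plane are pairs z = (x, t), frequencies are pairs (xi, tau).
   R[i] is used purely algebraically; limits, derivatives and integrals of
   complex-valued functions are taken on real and imaginary parts. *)

Local Notation normc := ComplexField.Normc.normc.

Section Schwartz.
Context {R : realType}.
Implicit Types (u : R * R -> R[i]) (z : R * R).

Definition ccontinuous u : Prop :=
  continuous (fun z => complex.Re (u z)) /\ continuous (fun z => complex.Im (u z)).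

Definition derivable_x u z : Prop :=
  derivable (fun x => complex.Re (u (x, z.2))) z.1 1 /\
  derivable (fun x => complex.Im (u (x, z.2))) z.1 1.

Definition derivable_t u z : Prop :=
  derivable (fun t => complex.Re (u (z.1, t))) z.2 1 /\
  derivable (fun t => complex.Im (u (z.1, t))) z.2 1.

Definition partial_x u z : R[i] :=
  derive1 (fun x => complex.Re (u (x, z.2))) z.1 +i*
  derive1 (fun x => complex.Im (u (x, z.2))) z.1.

Definition partial_t u z : R[i] :=
  derive1 (fun t => complex.Re (u (z.1, t))) z.2 +i*
  derive1 (fun t => complex.Im (u (z.1, t))) z.2.

Fixpoint Cn (n : nat) u : Prop :=
  ccontinuous u /\
  (if n is n'.+1 then
     [/\ forall z, derivable_x u z /\ derivable_t u z,
         Cn n' (partial_x u) & Cn n' (partial_t u)]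
   else True).

Definition schwartz u : Prop :=
  (forall n, Cn n u) /\
  (forall a b m n : nat, exists M : R, forall z,
     `|z.1 ^+ a * z.2 ^+ b| *
       normc (iter m partial_x (iter n partial_t u) z) <= M).

End Schwartz.

Section Bourgain.
Context {R : realType}.
Implicit Types (u : R * R -> R[i]).

Definition lebesgue2 := ((@lebesgue_measure R) \x (@lebesgue_measure R))%E.

Definition cintegral u : R[i] :=
  (\int[lebesgue2]_(z in setT) complex.Re (u z)) +i*
  (\int[lebesgue2]_(z in setT) complex.Im (u z)).

(* exp (i theta) *)
Definition expi (theta : R) : R[i] := cos theta +i* sin theta.

Definition fourier u (zeta : R * R) : R[i] :=
  cintegral (fun z => expi (- (z.1 * zeta.1)) * expi (- (z.2 * zeta.2)) * u z).

Definition japanese (w : R[i]) : R :=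
  Num.sqrt (1 + normc w ^+ 2).

Definition Xweight (b s alpha : R) (zeta : R * R) : R :=
  japanese ((`|zeta.1| `^ (2 * alpha)) +i* (zeta.2 - zeta.1 ^+ 3)) `^ b
  * japanese zeta.1%:C `^ s.

(* The L^2 norm of a complex-valued function is that of its modulus. *)
Definition Xnorm (b s alpha : R) u : \bar R :=
  'N[lebesgue2]_2%:E[EFin \o (fun zeta =>
    normc ((Xweight b s alpha zeta)%:C * fourier u zeta)%R)]%E.

Definition s_crit (alpha : R) : R :=
  if alpha <= 1 / 2 then - (3 / 4) else - (3 / (5 - 2 * alpha)).

End Bourgain.

(* Main.v *)
Require Import Defs.
From mathcomp Require Import all_boot all_order all_algebra.
From mathcomp Require Import all_classical all_reals all_analysis.
From mathcomp.real_closed Require Import complex.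
From mathcomp Require Import ring lra.
From mathcomp Require Import measurable_realfun.

Import Order.TTheory GRing.Theory Num.Theory.
Import numFieldNormedType.Exports.

Local Open Scope ring_scope.

(** The estimate is defeated by two wave packets with opposite carrier
    frequencies [N] and [- N], whose product falls at low frequency.

    The spectrum of each packet fills the parallelogram of length [a] and
    thickness [T] tangent to the curve [tau = xi^3] at [(N, N^3)] or at the
    opposite point. The thickness is [T = N^(2 alpha)], the size of the
    dissipation there, so that the weight is of order [T] on the whole packet
    and the thickness costs nothing; the length is the largest one for which
    the tangent stays within [T] of the curve, that is [N a^2 = T], or
    [a = N^(alpha - 1/2)]. Normalising the profiles to Gaussians with the value
    1 at the origin gives each packet a squared norm of order [N^(2 s) / a]
    ([Xnorm_wave_le] with [Xweight_spectrum_le]).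

    The product is a Gaussian whose spectrum lies along the line
    [tau = 3 N^2 xi], for [|xi|] of order [a]. There the distance to the cubic
    is of order [N^2 a], and the bracket of [xi] has size [max 1 a], so that
    the squared norm of the derivative of the product is at least of order
    [(N^2 a)^(-1 + 2 delta) (max 1 a)^(2 s) a / T]
    ([Xnorm_derivative_sgauss_ge] with [Xweight_box_ge]).

    Comparing the two sides, the estimate would bound
    [(N^2 a)^(2 delta) N^(2 s beta - 3 - 4 s)] uniformly in [N], where
    [beta = max 0 (alpha - 1/2)]. The critical regularity is the one for which
    the second exponent vanishes ([s_crit_exponent]); at or below it the bounded
    quantity is at least [N^(2 delta)], which is absurd for large [N]. Any
    [delta < 1/2] will do: the output weight must only have a negative exponent.

    Gaussian profiles make every Fourier transform explicit. The one-dimensional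
    transform comes from a linear differential equation in the frequency
    ([Rintegral_cosgau]), the planar one by integrating along the shear
    ([Rintegral_cos_sgauss]). The tails of the Gaussians are harmless because
    the weights grow polynomially in the coordinates of the parallelogram. *)

Set Implicit Arguments.
Unset Strict Implicit.

(** * Derivatives of explicit functions *)

(** The rules are stated on functions given by their values, so that the tactic
    [isd] below can differentiate a closed formula by following its syntax. *)
Section derive_rules.
Context {R : realType}.
Implicit Types (f g : R -> R) (x y k df dg : R).

Lemma isd_eq f x df dg : is_derive x 1 f df -> df = dg -> is_derive x 1 f dg.
Proof. by move=> ? <-. Qed.

Lemma isd_cst k x : is_derive x 1 (fun=> k) 0.
Proof. exact: is_derive_cst. Qed.

Lemma isd_id x : is_derive x 1 (fun y => y) 1.
Proof. exact: is_derive_id. Qed.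

Lemma isd_add f g x df dg : is_derive x 1 f df -> is_derive x 1 g dg ->
  is_derive x 1 (fun y => f y + g y) (df + dg).
Proof. by move=> ? ?; exact: is_deriveD. Qed.

Lemma isd_opp f x df : is_derive x 1 f df -> is_derive x 1 (fun y => - f y) (- df).
Proof. by move=> ?; exact: is_deriveN. Qed.

Lemma isd_mul f g x df dg : is_derive x 1 f df -> is_derive x 1 g dg ->
  is_derive x 1 (fun y => f y * g y) (f x * dg + g x * df).
Proof. by move=> ? ?; exact: is_deriveM. Qed.

Lemma isd_exp f n x df : is_derive x 1 f df ->
  is_derive x 1 (fun y => f y ^+ n) (n%:R * f x ^+ n.-1 * df).
Proof.
move=> ?; case: n => [|n]; first by rewrite !mul0r; exact: is_derive_cst.
rewrite (_ : (fun y => _) = f ^+ n.+1); last by apply/funext => y; rewrite exprfctE.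
by apply: is_derive_eq.
Qed.

Lemma isd_cos f x df : is_derive x 1 f df ->
  is_derive x 1 (fun y => cos (f y)) (- sin (f x) * df).
Proof. by move=> ?; exact: is_derive1_comp. Qed.

Lemma isd_sin f x df : is_derive x 1 f df ->
  is_derive x 1 (fun y => sin (f y)) (cos (f x) * df).
Proof. by move=> ?; exact: is_derive1_comp. Qed.

Lemma isd_expR f x df : is_derive x 1 f df ->
  is_derive x 1 (fun y => expR (f y)) (expR (f x) * df).
Proof. by move=> ?; exact: is_derive1_comp. Qed.

End derive_rules.

(** Plain [refine] keeps the instances of [is_derive] out of the way: they
    would otherwise close subgoals with derivatives written with scalings. *)
Ltac isd_step :=
  first [notypeclasses refine (isd_cst _ _) | notypeclasses refine (isd_id _)
        | notypeclasses refine (isd_add _ _) | notypeclasses refine (isd_opp _)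
        | notypeclasses refine (isd_mul _ _) | notypeclasses refine (isd_exp _ _)
        | notypeclasses refine (isd_cos _) | notypeclasses refine (isd_sin _)
        | notypeclasses refine (isd_expR _)].

(** Leaves the equality between the derivative produced by the rules and the
    expected one; [isd_with tac] first tries [tac] on each subfunction, for
    functions whose derivative is known as a lemma. *)
Ltac isd := notypeclasses refine (isd_eq _ _); [repeat isd_step|].

Ltac isd_with tac := notypeclasses refine (isd_eq _ _); [repeat first [tac | isd_step]|].

(** * Sheared Gaussian wave packets are Schwartz functions *)

Section sgauss.
Context {R : realType}.
Variables a c T : R.

(** The shear [x + c t] tilts the frequency support along the line
    [tau = c xi]: with [c] the slope of the curve [tau = xi^3] at the carrier
    frequency, the spectrum follows the curve over a long stretch. *)
Definition sgauss (z : R * R) : R :=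
  expR (- ((a * (z.1 + c * z.2)) ^+ 2 + (T * z.2) ^+ 2) / 2).

Variables p q : R.

(** The phase shift [th] lets one formula cover cosines and sines, which makes
    the span of these functions stable under differentiation. *)
Definition packet (k : R) (i j : nat) (th : R) (z : R * R) : R :=
  k * z.1 ^+ i * z.2 ^+ j * cos (p * z.1 + q * z.2 + th) * sgauss z.

Lemma is_derive_packet_x k i j th x t :
  is_derive x (1 : R) (fun x => packet k i j th (x, t))
    (packet (k * i%:R) i.-1 j th (x, t) + packet (k * p) i j (th + pi / 2) (x, t)
     + (packet (- (k * a ^+ 2)) i.+1 j th (x, t) + packet (- (k * a ^+ 2 * c)) i j.+1 th (x, t))).
Proof.
rewrite /packet /sgauss /=.
rewrite (addrA _ th) cosDpihalf; isd; rewrite (exprS x) (exprS t) /=.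
by field.
Qed.

Lemma is_derive_packet_t k i j th x t :
  is_derive t (1 : R) (fun t => packet k i j th (x, t))
    (packet (k * j%:R) i j.-1 th (x, t) + packet (k * q) i j (th + pi / 2) (x, t)
     + (packet (- (k * a ^+ 2 * c)) i.+1 j th (x, t)
       + packet (- (k * (a ^+ 2 * c ^+ 2 + T ^+ 2))) i j.+1 th (x, t))).
Proof.
rewrite /packet /sgauss /=.
rewrite (addrA _ th) cosDpihalf; isd; rewrite (exprS x) (exprS t) /=.
by field.
Qed.

(** The span of the packets. Stability under both partial derivatives gives
    smoothness of every order at once, and decay of one member at a time gives
    the decay of all derivatives. *)
Inductive tame : (R * R -> R) -> Prop :=
| tame_packet k i j th : tame (packet k i j th)
| tame_add f g : tame f -> tame g -> tame (fun z => f z + g z).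

Lemma tame_derive_x f : tame f ->
  exists2 f', tame f' & forall x t, is_derive x (1 : R) (fun x => f (x, t)) (f' (x, t)).
Proof.
elim=> [k i j th|g h _ [g' tg dg] _ [h' th dh]].
- exists (fun z => packet (k * i%:R) i.-1 j th z + packet (k * p) i j (th + pi / 2) z
     + (packet (- (k * a ^+ 2)) i.+1 j th z + packet (- (k * a ^+ 2 * c)) i j.+1 th z));
    last by move=> x t; exact: is_derive_packet_x.
  by do ![apply: tame_add|apply: tame_packet].
- exists (fun z => g' z + h' z); last by move=> x t; exact: isd_add.
  exact: tame_add.
Qed.

Lemma tame_derive_t f : tame f ->
  exists2 f', tame f' & forall x t, is_derive t (1 : R) (fun t => f (x, t)) (f' (x, t)).
Proof.
elim=> [k i j th|g h _ [g' tg dg] _ [h' th dh]].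
- exists (fun z => packet (k * j%:R) i j.-1 th z + packet (k * q) i j (th + pi / 2) z
     + (packet (- (k * a ^+ 2 * c)) i.+1 j th z
       + packet (- (k * (a ^+ 2 * c ^+ 2 + T ^+ 2))) i j.+1 th z));
    last by move=> x t; exact: is_derive_packet_t.
  by do ![apply: tame_add|apply: tame_packet].
- exists (fun z => g' z + h' z); last by move=> x t; exact: isd_add.
  exact: tame_add.
Qed.

Lemma continuous_tame f : tame f -> continuous f.
Proof.
elim=> [k i j th|g h _ cg _ ch]; last first.
  by move=> z; apply: cvgD; [exact: cg|exact: ch].
have cx : continuous (fun z : R * R => z.1) by move=> z; exact: cvg_fst.
have ct : continuous (fun z : R * R => z.2) by move=> z; exact: cvg_snd.
have cc k' : continuous (fun z : R * R => k' : R) by move=> z; exact: cvg_cst.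
have cM (f1 f2 : R * R -> R) : continuous f1 -> continuous f2 ->
    continuous (fun z => f1 z * f2 z).
  by move=> c1 c2 z; apply: cvgM; [exact: c1|exact: c2].
have cD (f1 f2 : R * R -> R) : continuous f1 -> continuous f2 ->
    continuous (fun z => f1 z + f2 z).
  by move=> c1 c2 z; apply: cvgD; [exact: c1|exact: c2].
have cX (f1 : R * R -> R) n : continuous f1 -> continuous (fun z => f1 z ^+ n).
  move=> c1; elim: n => [|n IH]; first exact: cc.
  rewrite (_ : (fun z => f1 z ^+ n.+1) = (fun z => f1 z * f1 z ^+ n)); first exact: cM.
  by apply/funext => z; rewrite exprS.
rewrite /packet /sgauss; apply: (cM); [apply: (cM)|].
- by apply: (cM); [apply: (cM)|] => //; exact: cX.
- have cphase : continuous (fun z : R * R => p * z.1 + q * z.2 + th).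
    by apply: (cD) => //; apply: (cD); exact: (cM).
  by move=> z; apply: (continuous_comp (cphase z)); exact: continuous_cos.
- have cquad : continuous (fun z : R * R =>
      (-1 * ((a * (z.1 + c * z.2)) ^+ 2 + (T * z.2) ^+ 2)) / 2).
    apply: (cM) => //; apply: (cM) => //.
    apply: (cD); apply: (cX); apply: (cM) => //; apply: (cD) => //; exact: (cM).
  rewrite (_ : (fun z => _) = expR \o (fun z : R * R =>
      (-1 * ((a * (z.1 + c * z.2)) ^+ 2 + (T * z.2) ^+ 2)) / 2)).
    by move=> z; apply: continuous_comp; [exact: cquad|exact: continuous_expR].
  by apply/funext => z; rewrite /= mulN1r.
Qed.

Hypothesis a0 : 0 < a.
Hypothesis T0 : 0 < T.

Lemma expr_le_expR (y : R) (n : nat) : `|y| ^+ n <= n`!%:R * expR `|y|.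
Proof.
case: n => [|n]; first by rewrite mul1r; apply: le_trans (expR_ge1Dx _); rewrite lerDl.
rewrite -ler_pdivrMl ?ltr0n ?fact_gt0// mulrC.
by apply: le_trans (expR_ge1Dxn n (normr_ge0 y)); rewrite lerDr.
Qed.

(** Exponentials dominate monomials, and [|x| + |t|] is at most
    [|x + c t| + (1 + |c|) |t|], which the quadratic exponent absorbs up to a
    constant. *)
Lemma bounded_monomial_sgauss (i j : nat) :
  exists2 M, 0 <= M & forall z, `|z.1| ^+ i * `|z.2| ^+ j * sgauss z <= M.
Proof.
pose E := a ^- 2 / 2 + (1 + `|c|) ^+ 2 / T ^+ 2 / 2.
exists (i`!%:R * j`!%:R * expR E); first by rewrite !mulr_ge0 ?expR_ge0.
move=> [x t] /=.
have le1 : `|x| + `|t| <= `|x + c * t| + (1 + `|c|) * `|t|.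
  have : `|x| <= `|x + c * t| + `|c| * `|t|.
    by rewrite -normrM; rewrite -[X in `|X| <= _](addrK (c * t)); exact: ler_normB.
  lra.
(* Both estimates are instances of [u v <= u^2 / 2 + v^2 / 2]. *)
have le2 : `|x + c * t| <= (a * (x + c * t)) ^+ 2 / 2 + a ^- 2 / 2.
  rewrite -(real_normK (num_real (a * _))) normrM (gtr0_norm a0).
  have := sqr_ge0 (a * `|x + c * t| - a^-1).
  rewrite sqrrB -exprVn mulrAC mulfV ?gt_eqF// mul1r; lra.
have le3 : (1 + `|c|) * `|t| <= (T * t) ^+ 2 / 2 + (1 + `|c|) ^+ 2 / T ^+ 2 / 2.
  rewrite -(real_normK (num_real (T * _))) normrM (gtr0_norm T0) -expr_div_n.
  have := sqr_ge0 (T * `|t| - (1 + `|c|) / T).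
  rewrite sqrrB.
  have -> : T * `|t| * ((1 + `|c|) / T) = (1 + `|c|) * `|t|.
    by field; rewrite gt_eqF.
  lra.
have le4 : expR (`|x| + `|t|) * sgauss (x, t) <= expR E.
  by rewrite /sgauss -expRD ler_expR /E /=; lra.
apply: le_trans (ler_wpM2l _ le4); last by rewrite mulr_ge0.
rewrite mulrA ler_wpM2r ?expR_ge0// expRD mulrACA.
by rewrite ler_pM ?exprn_ge0 ?expr_le_expR.
Qed.

Lemma tame_rapidly_decreasing f (i j : nat) : tame f ->
  exists M, forall z, `|z.1 ^+ i * z.2 ^+ j| * `|f z| <= M.
Proof.
elim=> [k i' j' th|g h _ [M gM] _ [M' hM']]; last first.
  exists (M + M') => z; apply: le_trans (lerD (gM z) (hM' z)).
  by rewrite -mulrDr ler_wpM2l ?ler_normD.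
have [M M0 bM] := bounded_monomial_sgauss (i + i') (j + j').
exists (`|k| * M) => z.
apply: le_trans (ler_wpM2l _ (bM z)) => //.
rewrite /packet !normrM !normrX !exprD (ger0_norm (expR_ge0 _)) -/(sgauss z).
rewrite [leLHS](_ : _ = `|k| * (`|z.1| ^+ i * `|z.1| ^+ i' *
  (`|z.2| ^+ j * `|z.2| ^+ j') * sgauss z) * `|cos (p * z.1 + q * z.2 + th)|); last by ring.
by rewrite ler_piMr ?cos_max// !mulr_ge0 ?exprn_ge0 ?expR_ge0.
Qed.

Definition ctame (u : R * R -> R[i]) : Prop :=
  tame (fun z => complex.Re (u z)) /\ tame (fun z => complex.Im (u z)).

Lemma ctame_partial_x u : ctame u ->
  (forall z, derivable_x u z) /\ ctame (partial_x u).
Proof.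
move=> [/tame_derive_x[f tf df] /tame_derive_x[g tg dg]]; split.
  by case=> x t; split; [case: (df x t)|case: (dg x t)].
split.
  rewrite (_ : (fun z => _) = f)//; apply/funext => -[x t].
  by rewrite /partial_x /= derive1E; apply: derive_val.
rewrite (_ : (fun z => _) = g)//; apply/funext => -[x t].
by rewrite /partial_x /= derive1E; apply: derive_val.
Qed.

Lemma ctame_partial_t u : ctame u ->
  (forall z, derivable_t u z) /\ ctame (partial_t u).
Proof.
move=> [/tame_derive_t[f tf df] /tame_derive_t[g tg dg]]; split.
  by case=> x t; split; [case: (df x t)|case: (dg x t)].
split.
  rewrite (_ : (fun z => _) = f)//; apply/funext => -[x t].
  by rewrite /partial_t /= derive1E; apply: derive_val.
rewrite (_ : (fun z => _) = g)//; apply/funext => -[x t].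
by rewrite /partial_t /= derive1E; apply: derive_val.
Qed.

Lemma ctame_Cn n u : ctame u -> Cn n u.
Proof.
elim: n u => [|n IH] u tu /=; (split; first by case: tu => *; split; exact: continuous_tame) => //.
have [dx tx] := ctame_partial_x tu; have [dt tt'] := ctame_partial_t tu.
by split; [split|exact: IH|exact: IH].
Qed.

Lemma normc_le (w : R[i]) :
  ComplexField.Normc.normc w <= `|complex.Re w| + `|complex.Im w|.
Proof.
case: w => x y /=; rewrite -[leRHS]ger0_norm ?addr_ge0// -sqrtr_sqr ler_wsqrtr//.
rewrite sqrrD !real_normK ?num_real//.
by rewrite lerD2r lerDl mulrn_wge0 ?mulr_ge0.
Qed.

Lemma ctame_schwartz u : ctame u -> schwartz u.
Proof.
move=> tu; split => [n|i j m n]; first exact: ctame_Cn.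
have : ctame (iter m partial_x (iter n partial_t u)).
  elim: m => [|m IH] /=; last by case: (ctame_partial_x IH).
  by elim: n => //= n IH; case: (ctame_partial_t IH).
move: (iter m _ _) => w [/(tame_rapidly_decreasing i j)[M wM] /(tame_rapidly_decreasing i j)[M' wM']].
exists (M + M') => z; apply: le_trans (lerD (wM z) (wM' z)).
by rewrite -mulrDr ler_wpM2l// normc_le.
Qed.

End sgauss.

(** * The Fourier transform of a Gaussian on the line *)

Section calculus.
Local Open Scope classical_set_scope.
Local Open Scope ring_scope.
Context {R : realType}.
Notation mu := (@lebesgue_measure R).
Implicit Types F f : R -> R.

Lemma continuous_of_is_derive F f : (forall x : R, is_derive x 1 F (f x)) -> continuous F.
Proof.
by move=> dF x; apply: differentiable_continuous; apply/derivable1_diffP; case: (dF x).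
Qed.

Lemma measurable_of_is_derive F f : (forall x : R, is_derive x 1 F (f x)) -> measurable_fun setT F.
Proof. by move=> /continuous_of_is_derive; exact: continuous_measurable_fun. Qed.

(** The integral over [-n, n] is the difference of the boundary values, and
    dominated convergence lets [n] grow. *)
Lemma Rintegral_derivative_line F f :
  (forall x : R, is_derive x 1 F (f x)) -> continuous f ->
  mu.-integrable setT (EFin \o f) ->
  (F n.+1%:R @[n --> \oo] --> (0 : R))%classic ->
  (F (- n.+1%:R) @[n --> \oo] --> (0 : R))%classic ->
  \int[mu]_x f x = 0.
Proof.
move=> dF cf intf Fp Fm.
have ab n : - n.+1%:R < n.+1%:R :> R by rewrite gtrN.
pose I n : set R := `[- n.+1%:R, n.+1%:R]%classic.
have mf := measurable_int _ intf.
pose fn n := ((EFin \o f) \_ (I n))%E.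
have mI n : measurable (I n) by rewrite /I; exact: measurable_itv.
have mfn n : measurable_fun setT (fn n).
  by apply: (iffLR (measurable_restrictT (EFin \o f) (mI n))); exact: measurable_funS mf.
have lim x : (fn n x @[n --> \oo] --> (f x)%:E)%classic.
  apply: cvg_near_cst; exists (Num.truncn `|x|) => // n /= nx.
  rewrite /fn patchE mem_set //= /I /= in_itv /= -ler_norml.
  apply: ltW; apply: lt_le_trans (truncnS_gt _) _.
  by rewrite ler_nat ltnS.
have [|||_ _ H] := @dominated_convergence _ _ _ mu setT measurableT fn (EFin \o f)
  (fun x => `|(f x)%:E|)%E mfn mf.
- by apply: aeW => x _; exact: lim.
- by apply: integrable_abse.
- apply: aeW => x n _; rewrite /fn patchE; case: ifP => _ //.
  by rewrite abse0.
have E n : (\int[mu]_x fn n x = (F n.+1%:R - F (- n.+1%:R))%:E)%E.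
  rewrite /fn -integral_mkcond; apply: continuous_FTC2 => //.
  - exact: continuous_subspaceT.
  - have cF := continuous_of_is_derive dF.
    split; first by move=> x _; case: (dF x).
      exact: cvg_at_right_filter (cF _).
    exact: cvg_at_left_filter (cF _).
  - by move=> x _; rewrite derive1E; apply: derive_val.
have {}H : (fun n => (F n.+1%:R - F (- n.+1%:R))%:E) @ \oo --> (\int[mu]_x (f x)%:E)%E.
  by move: H; under eq_fun do rewrite E.
have H0 : (fun n => (F n.+1%:R - F (- n.+1%:R))%:E) @ \oo --> (0%:E : \bar R).
  by apply: cvg_EFin; [exact: nearW|rewrite -(subr0 0); exact: cvgB].
by rewrite /Rintegral (cvg_unique _ H H0).
Qed.

End calculus.

Section gaussian.
Local Open Scope classical_set_scope.
Local Open Scope ring_scope.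
Context {R : realType}.
Notation mu := (@lebesgue_measure R).
Variables (m s : R).
Hypothesis s0 : 0 < s.

Definition gau (x : R) : R := expR (- ((x - m) / s) ^+ 2 / 2).

Lemma gau_ge0 x : 0 <= gau x. Proof. exact: expR_ge0. Qed.

Lemma gauE x : gau x = s * Num.sqrt (2 * pi) * normal_pdf m s x.
Proof.
rewrite normal_pdfE ?gt_eqF// /normal_peak /normal_fun.
rewrite -mulrnAr [Num.sqrt (s ^+ 2 * _)]sqrtrM ?sqr_ge0// sqrtr_sqr gtr0_norm// -[pi *+ 2]mulr_natl mulrA mulfV.
  by rewrite mul1r /gau; congr expR; field; rewrite gt_eqF.
by rewrite mulf_neq0 ?gt_eqF// sqrtr_gt0 mulr_gt0 ?pi_gt0.
Qed.

Lemma integrable_gau : mu.-integrable setT (EFin \o gau).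
Proof.
rewrite (_ : EFin \o gau = fun x => ((s * Num.sqrt (2 * pi))%:E * (normal_pdf m s x)%:E)%E); last first.
  by apply/funext => x; rewrite /= gauE EFinM.
by apply: integrableZl => //; exact: integrable_normal_pdf.
Qed.

Lemma integral_gau : (\int[mu]_x (gau x)%:E = (s * Num.sqrt (2 * pi))%:E)%E.
Proof.
under eq_integral do rewrite gauE EFinM.
rewrite integralZl//; last exact: integrable_normal_pdf.
by rewrite integral_normal_pdf mule1.
Qed.

Lemma Rintegral_gau : \int[mu]_x gau x = s * Num.sqrt (2 * pi).
Proof. by rewrite /Rintegral integral_gau. Qed.

Lemma is_derive_gau (x : R) : is_derive x 1 gau (- ((x - m) / s ^+ 2) * gau x).
Proof. by rewrite /gau; isd => /=; field; rewrite gt_eqF. Qed.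

(** Any rate tending to zero is enough to make boundary terms vanish; this one
    only needs [1 + y <= exp y]. *)
Lemma gau_decay x : gau x <= (s + `|m| + 1) / (`|x| + 1).
Proof.
rewrite ler_pdivlMr ?ltr_wpDl// /gau; set y := (x - m) / s.
have xm : x - m = s * y by rewrite /y; field; rewrite gt_eqF.
have h1 : `|x| <= s * `|y| + `|m|.
  by rewrite -[X in `|X| <= _](subrK m) xm (le_trans (ler_normD _ _))// normrM (gtr0_norm s0).
have h2 : `|y| <= 1 + y ^+ 2 / 2.
  by rewrite -(real_normK (num_real y)); have := sqr_ge0 (`|y| - 1); rewrite sqrrB; lra.
have h3 : 1 + y ^+ 2 / 2 <= expR (y ^+ 2 / 2) by exact: expR_ge1Dx.
rewrite mulNr expRN mulrC ler_pdivrMr ?expR_gt0//.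
apply: (@le_trans _ _ ((s + `|m| + 1) * (1 + y ^+ 2 / 2))); last first.
  by rewrite ler_wpM2l// !addr_ge0// ltW.
have := ler_wpM2l (ltW s0) h2; have := normr_ge0 m; have := sqr_ge0 y; nra.
Qed.

Lemma cvg_sin_gau th xi (e : nat -> R) : (forall n, n.+1%:R <= `|e n| + 1) ->
  (sin ((e n - m) * xi + th) * gau (e n) @[n --> \oo] --> (0 : R))%classic.
Proof.
move=> he; apply: norm_cvg0.
apply: (@squeeze_cvgr _ _ _ _ (cst 0) (fun n => (s + `|m| + 1) * harmonic n)).
- apply: nearW => n; rewrite normr_ge0/= normrM (ger0_norm (gau_ge0 _)).
  apply: (@le_trans _ _ (gau (e n))); first by rewrite ler_piMl ?gau_ge0// sin_max.
  apply: le_trans (gau_decay _) _; rewrite ler_wpM2l ?addr_ge0 ?(ltW s0)//.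
  by rewrite lef_pV2 ?posrE ?ltr_wpDl.
- exact: cvg_cst.
- by rewrite -(mulr0 (s + `|m| + 1)); apply: cvgMl_tmp; exact: cvg_harmonic.
Qed.

(** A Gaussian wider by the factor [sqrt 2] absorbs a linear factor. It serves
    as the dominating function when differentiating under the integral. *)
Lemma norm_mul_gau_le x : `|x - m| * gau x <= s * expR (- ((x - m) / (Num.sqrt 2 * s)) ^+ 2 / 2).
Proof.
rewrite /gau; set y := (x - m) / s.
have -> : x - m = s * y by rewrite /y; field; rewrite gt_eqF.
have -> : s * y / (Num.sqrt 2 * s) = y / Num.sqrt 2.
  by field; rewrite !gt_eqF// sqrtr_gt0.
clearbody y; rewrite expr_div_n sqr_sqrtr// normrM (gtr0_norm s0) -mulrA ler_wpM2l ?(ltW s0)//.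
rewrite -ler_pdivlMr ?expR_gt0// -expRN -expRD.
apply: le_trans (expR_ge1Dx _).
rewrite -(real_normK (num_real y)); have := sqr_ge0 (`|y| - 2).
rewrite sqrrB; lra.
Qed.

End gaussian.

Section gaussian_fourier.
Local Open Scope classical_set_scope.
Local Open Scope ring_scope.
Context {R : realType}.
Notation mu := (@lebesgue_measure R).
Variables (m s : R).
Hypothesis s0 : 0 < s.

Lemma integrable_le_gau (g : R -> R) (C D : R) : measurable_fun setT g ->
  (forall x, `|g x| <= (C + D * `|x - m|) * gau m s x) ->
  mu.-integrable setT (EFin \o g).
Proof.
move=> mg gle.
have s2 : 0 < Num.sqrt 2 * s by rewrite mulr_gt0 ?sqrtr_gt0.
apply: (@le_integrable _ _ _ mu _ measurableT _
  (EFin \o (fun x => `|C| * gau m s x + (`|D| * s) * gau m (Num.sqrt 2 * s) x))).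
- exact/measurable_EFinP.
- move=> x _; rewrite lee_fin.
  apply: (le_trans (gle x)); apply: le_trans (ler_norm _).
  rewrite mulrDl lerD//; first by rewrite ler_wpM2r ?gau_ge0 ?ler_norm.
  rewrite -mulrA -[leRHS]mulrA; apply: (@le_trans _ _ (`|D| * (`|x - m| * gau m s x))).
    by rewrite ler_wpM2r ?ler_norm// mulr_ge0 ?gau_ge0.
  by rewrite ler_wpM2l// norm_mul_gau_le.
- apply: (@integrableD _ _ _ mu setT measurableT
    (EFin \o (fun x => `|C| * gau m s x)) (EFin \o (fun x => `|D| * s * gau m (Num.sqrt 2 * s) x))).
    exact: (integrableZl measurableT _ (integrable_gau m s0)).
  exact: (integrableZl measurableT _ (integrable_gau m s2)).
Qed.

Variable th : R.
Implicit Types xi x y : R.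

Definition cosgau xi x := cos ((x - m) * xi + th) * gau m s x.
Definition xsingau xi x := (x - m) * sin ((x - m) * xi + th) * gau m s x.

Lemma measurable_cosgau xi : measurable_fun setT (cosgau xi).
Proof.
eapply measurable_of_is_derive => x; rewrite /cosgau.
by isd_with ltac:(exact: (is_derive_gau m s0)).
Qed.

Lemma measurable_xsingau xi : measurable_fun setT (xsingau xi).
Proof.
eapply measurable_of_is_derive => x; rewrite /xsingau.
by isd_with ltac:(exact: (is_derive_gau m s0)).
Qed.

Lemma integrable_cosgau xi : mu.-integrable setT (EFin \o cosgau xi).
Proof.
apply: (@integrable_le_gau _ 1 0) => [|x]; first exact: measurable_cosgau.
by rewrite mul0r addr0 mul1r normrM (ger0_norm (gau_ge0 _ _ _)) ler_piMl ?gau_ge0// cos_max.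
Qed.

Lemma norm_xsingau xi x : `|xsingau xi x| <= `|x - m| * gau m s x.
Proof.
rewrite !normrM (ger0_norm (gau_ge0 _ _ _)) ler_wpM2r ?gau_ge0//.
by rewrite ler_piMr// sin_max.
Qed.

Lemma integrable_xsingau xi : mu.-integrable setT (EFin \o xsingau xi).
Proof.
apply: (@integrable_le_gau _ 0 1) => [|x]; first exact: measurable_xsingau.
by rewrite add0r mul1r norm_xsingau.
Qed.

Lemma is_derive_Rintegral_cosgau (xi : R) :
  is_derive xi 1 (fun xi => \int[mu]_x cosgau xi x) (- \int[mu]_x xsingau xi x).
Proof.
have dC (y x : R) : is_derive y 1 (cosgau ^~ x) (- xsingau y x).
  by rewrite /cosgau /xsingau; isd => /=; ring.
have s2 : 0 < Num.sqrt 2 * s by rewrite mulr_gt0 ?sqrtr_gt0.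
pose G x := s * gau m (Num.sqrt 2 * s) x.
have G0 x : 0 <= G x by rewrite mulr_ge0 ?gau_ge0 ?ltW.
have intG : mu.-integrable setT (EFin \o G).
  exact: (integrableZl measurableT _ (integrable_gau m s2)).
have I : (`]xi - 1, xi + 1[%classic : set R) xi.
  by rewrite /= in_itv /= ltrBlDr ltrDl ltr01.
have d1 y x : partial1of2 cosgau y x = - xsingau y x.
  by rewrite /partial1of2 derive1E; apply: derive_val.
have ub y x : `]xi - 1, xi + 1[%classic y -> [set: R] x -> `|partial1of2 cosgau y x| <= G x.
  by move=> _ _; rewrite d1 normrN (le_trans (norm_xsingau _ _))// norm_mul_gau_le.
have der y x : `]xi - 1, xi + 1[%classic y -> [set: R] x -> derivable (cosgau ^~ x) y 1.
  by move=> _ _; case: (dC y x).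
have iC y : `]xi - 1, xi + 1[%classic y -> mu.-integrable setT (EFin \o cosgau y).
  by move=> _; exact: integrable_cosgau.
split.
  exact: (derivable_under_integral measurableT I iC der G0 intG ub).
rewrite -derive1E (differentiation_under_integral measurableT I iC der G0 intG ub).
under eq_Rintegral do rewrite d1 -mulN1r.
by rewrite RintegralZl ?mulN1r//; exact: integrable_xsingau.
Qed.

(** Integration by parts: the derivative of [sin (phase) * gau] has zero
    integral over the line. *)
Lemma Rintegral_xsingau xi : \int[mu]_x xsingau xi x = s ^+ 2 * xi * \int[mu]_x cosgau xi x.
Proof.
pose F x := sin ((x - m) * xi + th) * gau m s x.
pose f x := xi * cosgau xi x - s ^- 2 * xsingau xi x.
have dF (x : R) : is_derive x 1 F (f x).
  rewrite /F /f /cosgau /xsingau; isd_with ltac:(exact: (is_derive_gau m s0)).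
  by rewrite /=; field; rewrite gt_eqF.
have cf : continuous f.
  eapply continuous_of_is_derive => x; rewrite /f /cosgau /xsingau.
  by isd_with ltac:(exact: (is_derive_gau m s0)).
have i1 : mu.-integrable setT (EFin \o (fun x => xi * cosgau xi x)).
  exact: (integrableZl measurableT _ (integrable_cosgau xi)).
have i2 : mu.-integrable setT (EFin \o (fun x => s ^- 2 * xsingau xi x)).
  exact: (integrableZl measurableT _ (integrable_xsingau xi)).
have := @Rintegral_derivative_line _ F f dF cf.
rewrite /f RintegralB// RintegralZl// ?RintegralZl//; [|exact: integrable_xsingau|exact: integrable_cosgau].
have i3 : mu.-integrable setT (EFin \o f).
  exact: (integrableB measurableT i1 i2).
move=> /(_ i3) H.
have /eqP : xi * \int[mu]_x cosgau xi x - s ^- 2 * \int[mu]_x xsingau xi x = 0.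
  apply: H.
    apply: (@cvg_sin_gau _ m s s0 th xi (fun n => n.+1%:R)) => n.
    by rewrite ger0_norm// lerDl.
  apply: (@cvg_sin_gau _ m s s0 th xi (fun n => - n.+1%:R)) => n.
  by rewrite normrN ger0_norm// lerDl.
by rewrite subr_eq0 => /eqP E; rewrite -mulrA E mulrA mulfV ?mul1r// expf_neq0// gt_eqF.
Qed.

(** As a function of [xi] the integral solves [H' = - s^2 xi H], so that
    [H * exp (s^2 xi^2 / 2)] is constant. *)
Lemma Rintegral_cosgau xi :
  \int[mu]_x cosgau xi x = cos th * (s * Num.sqrt (2 * pi)) * expR (- (s * xi) ^+ 2 / 2).
Proof.
pose H xi := \int[mu]_x cosgau xi x.
pose K xi := H xi * expR ((s * xi) ^+ 2 / 2).
have dK (y : R) : is_derive y 1 K 0.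
  rewrite /K; isd_with ltac:(exact: is_derive_Rintegral_cosgau).
  by rewrite /= Rintegral_xsingau -/(H y); field.
have := is_derive_0_is_cst xi 0 dK; rewrite /K mulr0 expr0n /= mul0r expR0 mulr1.
have -> : H 0 = cos th * (s * Num.sqrt (2 * pi)).
  rewrite -(Rintegral_gau m s0) -RintegralZl//; last exact: integrable_gau.
  by apply: eq_Rintegral => x _; rewrite /cosgau mulr0 add0r.
by move=> <-; rewrite mulNr expRN -mulrA mulfV ?mulr1// gt_eqF ?expR_gt0.
Qed.

End gaussian_fourier.

(** * The Fourier transform of a sheared Gaussian *)

Section measurability_rules.
Local Open Scope classical_set_scope.
Local Open Scope ring_scope.
Context {R : realType} {d : measure_display} {T : measurableType d}.
Implicit Types (f g : T -> R).

Lemma meas_cst (k : R) : measurable_fun setT (fun _ : T => k).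
Proof. exact: measurable_cst. Qed.

Lemma meas_add f g : measurable_fun setT f -> measurable_fun setT g ->
  measurable_fun setT (fun z => f z + g z).
Proof. exact: measurable_funD. Qed.

Lemma meas_opp f : measurable_fun setT f -> measurable_fun setT (fun z => - f z).
Proof. exact: measurable_funN. Qed.

Lemma meas_mul f g : measurable_fun setT f -> measurable_fun setT g ->
  measurable_fun setT (fun z => f z * g z).
Proof. exact: measurable_funM. Qed.

Lemma meas_exp f n : measurable_fun setT f -> measurable_fun setT (fun z => f z ^+ n).
Proof. exact: measurable_funX. Qed.

Lemma meas_cos f : measurable_fun setT f -> measurable_fun setT (fun z => cos (f z)).
Proof. by apply: measurableT_comp; apply: continuous_measurable_fun; exact: continuous_cos. Qed.

Lemma meas_sin f : measurable_fun setT f -> measurable_fun setT (fun z => sin (f z)).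
Proof. by apply: measurableT_comp; apply: continuous_measurable_fun; exact: continuous_sin. Qed.

Lemma meas_expR f : measurable_fun setT f -> measurable_fun setT (fun z => expR (f z)).
Proof. by apply: measurableT_comp; exact: measurable_expR. Qed.

Lemma meas_norm f : measurable_fun setT f -> measurable_fun setT (fun z => `|f z|).
Proof. by apply: measurableT_comp; apply: continuous_measurable_fun; exact: norm_continuous. Qed.

Lemma meas_sqrt f : measurable_fun setT f -> measurable_fun setT (fun z => Num.sqrt (f z)).
Proof. by apply: measurableT_comp; apply: continuous_measurable_fun; exact: sqrt_continuous. Qed.

Lemma meas_powR f p : measurable_fun setT f -> measurable_fun setT (fun z => f z `^ p).
Proof. by apply: (measurableT_comp (f := fun x => x `^ p)); exact: measurable_powR. Qed.

End measurability_rules.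

Ltac meas_step := first
  [ exact: meas_cst | exact: measurable_fst | exact: measurable_snd
  | apply: meas_add | apply: meas_opp | apply: meas_mul | apply: meas_exp
  | apply: meas_cos | apply: meas_sin | apply: meas_expR | apply: meas_norm
  | apply: meas_sqrt | apply: meas_powR ].
Ltac meas := repeat meas_step.

Section sgauss_fourier.
Local Open Scope classical_set_scope.
Local Open Scope ring_scope.
Context {R : realType}.
Notation mu := (@lebesgue_measure R).
Notation mu2 := (@lebesgue2 R).
Implicit Types (a c T : R).

Lemma sgaussE a c T x t : a != 0 ->
  sgauss a c T (x, t) = gau (- (c * t)) a^-1 x * gau 0 T^-1 t.
Proof.
move=> a0; rewrite /sgauss /gau -expRD /=; congr expR.
by rewrite opprK subr0 !invrK; lra.
Qed.

Lemma measurable_sgauss a c T : measurable_fun setT (sgauss a c T).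
Proof. by rewrite /sgauss; meas. Qed.

Lemma sgauss_ge0 a c T z : 0 <= sgauss a c T z.
Proof. exact: expR_ge0. Qed.

Lemma integral_sgauss a c T : 0 < a -> 0 < T ->
  (\int[mu2]_z (sgauss a c T z)%:E = (2 * pi / (a * T))%:E)%E.
Proof.
move=> a0 T0; rewrite /lebesgue2 fubini_tonelli2//=; last 2 first.
- by apply/measurable_EFinP; exact: measurable_sgauss.
- by move=> z; rewrite lee_fin sgauss_ge0.
rewrite /fubini_G.
under eq_integral => t _.
  under eq_integral => x _ do rewrite sgaussE ?gt_eqF// EFinM.
  rewrite ge0_integralZr//=; last 3 first.
  - by apply/measurable_EFinP; rewrite /gau; meas.
  - by move=> x _; rewrite lee_fin gau_ge0.
  - by rewrite lee_fin gau_ge0.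
  rewrite integral_gau ?invr_gt0//.
  over.
rewrite ge0_integralZl//=; last 3 first.
- by apply/measurable_EFinP; rewrite /gau; meas.
- by move=> x _; rewrite lee_fin gau_ge0.
- by rewrite lee_fin mulr_ge0 ?invr_ge0 ?(ltW a0).
rewrite integral_gau ?invr_gt0// -EFinM; congr EFin.
rewrite mulrACA -expr2 sqr_sqrtr; last by rewrite mulr_ge0 ?pi_ge0.
by rewrite mulrC invfM.
Qed.

Lemma integrable_sgauss a c T : 0 < a -> 0 < T ->
  mu2.-integrable setT (EFin \o sgauss a c T).
Proof.
move=> a0 T0; apply/integrableP; split.
  by apply/measurable_EFinP; exact: measurable_sgauss.
under eq_integral do rewrite /= ger0_norm ?sgauss_ge0//.
by rewrite integral_sgauss// ltry.
Qed.

Lemma mul_shear_sgauss_le a c T z : 0 < a ->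
  `|z.1 + c * z.2| * sgauss a c T z <= a^-1 * sgauss (a / Num.sqrt 2) c T z.
Proof.
case: z => x t a0 /=; have a1 : 0 < a^-1 by rewrite invr_gt0.
have s2 : Num.sqrt 2 != 0 :> R by rewrite gt_eqF// sqrtr_gt0.
have := norm_mul_gau_le (- (c * t)) a1 x.
have -> : sgauss (a / Num.sqrt 2) c T (x, t) =
    expR (- ((x - - (c * t)) / (Num.sqrt 2 * a^-1)) ^+ 2 / 2) * gau 0 T^-1 t.
  rewrite /sgauss /gau -expRD /=; congr expR.
  by rewrite opprK subr0 invfM !invrK [a / _]mulrC [_ * (x + _)]mulrC; lra.
rewrite sgaussE ?gt_eqF// opprK !mulrA => H.
by rewrite ler_wpM2r ?gau_ge0.
Qed.

(** A linear factor in the sheared variable is allowed because the derivative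
    in [x] of the sheared Gaussian carries one. *)
Lemma integrable_le_sgauss a c T (k k' : R) (h : R * R -> R) : 0 < a -> 0 < T ->
  measurable_fun setT h ->
  (forall z, `|h z| <= (k + k' * `|z.1 + c * z.2|) * sgauss a c T z) ->
  mu2.-integrable setT (EFin \o h).
Proof.
move=> a0 T0 mh hle.
have a2 : 0 < a / Num.sqrt 2 by rewrite divr_gt0 ?sqrtr_gt0.
apply: (@le_integrable _ _ _ mu2 _ measurableT _
  (EFin \o (fun z => `|k| * sgauss a c T z + (`|k'| / a) * sgauss (a / Num.sqrt 2) c T z))).
- exact/measurable_EFinP.
- move=> z _; rewrite lee_fin.
  apply: (le_trans (hle z)); apply: le_trans (ler_norm _).
  rewrite mulrDl lerD//; first by rewrite ler_wpM2r ?sgauss_ge0 ?ler_norm.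
  rewrite -mulrA -[leRHS]mulrA.
  apply: (@le_trans _ _ (`|k'| * (`|z.1 + c * z.2| * sgauss a c T z))).
    by rewrite ler_wpM2r ?ler_norm// mulr_ge0 ?sgauss_ge0.
  by rewrite ler_wpM2l// mul_shear_sgauss_le.
- apply: (@integrableD _ _ _ mu2 setT measurableT
    (EFin \o (fun z => `|k| * sgauss a c T z))
    (EFin \o (fun z => `|k'| / a * sgauss (a / Num.sqrt 2) c T z))).
    exact: (integrableZl measurableT _ (integrable_sgauss c a0 T0)).
  exact: (integrableZl measurableT _ (integrable_sgauss c a2 T0)).
Qed.

Lemma Rintegral_iterated (h : R * R -> R) : mu2.-integrable setT (EFin \o h) ->
  (forall t, mu.-integrable setT (EFin \o (fun x => h (x, t)))) ->
  \int[mu2]_z h z = \int[mu]_t \int[mu]_x h (x, t).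
Proof.
move=> inth intx; rewrite {1}/Rintegral -(integral21_prod_meas1 inth).
congr fine; apply: eq_integral => t _; rewrite /fubini_G /Rintegral fineK//.
exact: (integrable_fin_num _ (intx t)).
Qed.

Variables (a c T : R).
Hypothesis a0 : 0 < a.
Hypothesis T0 : 0 < T.
Variables (xi tau th : R).

Let a10 : 0 < a^-1. Proof. by rewrite invr_gt0. Qed.
Let T10 : 0 < T^-1. Proof. by rewrite invr_gt0. Qed.

Definition phase (z : R * R) := z.1 * xi + z.2 * tau + th.

Let phaseE x t :
  phase (x, t) = (x - - (c * t)) * xi + ((t - 0) * (tau - c * xi) + th).
Proof. by rewrite /phase /=; ring. Qed.

Let K : R := cos th * (2 * pi / (a * T)) *
  expR (- ((xi / a) ^+ 2 + ((tau - c * xi) / T) ^+ 2) / 2).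

Let KE k : (a^-1 * Num.sqrt (2 * pi)) * k * expR (- (a^-1 * xi) ^+ 2 / 2) *
   (cos th * (T^-1 * Num.sqrt (2 * pi)) * expR (- (T^-1 * (tau - c * xi)) ^+ 2 / 2)) = k * K.
Proof.
have -> : K = cos th * (2 * pi / (a * T)) * (expR (- (a^-1 * xi) ^+ 2 / 2) *
    expR (- (T^-1 * (tau - c * xi)) ^+ 2 / 2)).
  by rewrite /K -expRD; congr (_ * expR _); field; rewrite !gt_eqF.
have /= H : Num.sqrt (2 * pi) ^+ 2 = 2 * pi :> R by rewrite sqr_sqrtr// mulr_ge0 ?pi_ge0.
rewrite -[X in X / (a * T)]H invfM; ring.
Qed.

(** For fixed [t] the integral in [x] is that of a Gaussian centred at [- c t];
    it leaves the phase [t (tau - c xi)] to the Gaussian in [t]. *)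
Lemma Rintegral_cos_sgauss :
  \int[mu2]_z (cos (phase z) * sgauss a c T z) =
  cos th * (2 * pi / (a * T)) *
  expR (- ((xi / a) ^+ 2 + ((tau - c * xi) / T) ^+ 2) / 2).
Proof.
rewrite -/K.
have E t x : cos (phase (x, t)) * sgauss a c T (x, t) =
    gau 0 T^-1 t * cosgau (- (c * t)) a^-1 ((t - 0) * (tau - c * xi) + th) xi x.
  by rewrite sgaussE ?gt_eqF// phaseE /cosgau; ring.
rewrite Rintegral_iterated.
- under eq_Rintegral => t _.
    under eq_Rintegral => x _ do rewrite E.
    rewrite RintegralZl//; last exact: integrable_cosgau.
    rewrite Rintegral_cosgau//.
    rewrite [X in _ * X](_ : _ = cos ((t - 0) * (tau - c * xi) + th) *
       (a^-1 * Num.sqrt (2 * pi) * expR (- (a^-1 * xi) ^+ 2 / 2))); last by ring.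
    rewrite mulrA [gau _ _ _ * _]mulrC.
    over.
  rewrite RintegralZr//; last exact: (integrable_cosgau 0 T10 th (tau - c * xi)).
  by rewrite (Rintegral_cosgau 0 T10 th (tau - c * xi)) mulrC -[RHS]mul1r -KE mulr1.
- apply: (@integrable_le_sgauss a c T 1 0) => //.
    by apply: meas_mul; [rewrite /phase; meas|exact: measurable_sgauss].
  move=> z; rewrite mul0r addr0 mul1r normrM (ger0_norm (sgauss_ge0 _ _ _ _)).
  by rewrite ler_piMl ?sgauss_ge0// cos_max.
- move=> t; rewrite (_ : _ \o _ = EFin \o (fun x => gau 0 T^-1 t *
    cosgau (- (c * t)) a^-1 ((t - 0) * (tau - c * xi) + th) xi x)).
    exact: (integrableZl measurableT _ (integrable_cosgau _ a10 _ _)).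
  by apply/funext => x /=; rewrite E.
Qed.

Lemma Rintegral_shear_sin_sgauss :
  \int[mu2]_z ((z.1 + c * z.2) * sin (phase z) * sgauss a c T z) =
  xi / a ^+ 2 * (cos th * (2 * pi / (a * T)) *
  expR (- ((xi / a) ^+ 2 + ((tau - c * xi) / T) ^+ 2) / 2)).
Proof.
rewrite -/K.
have E t x : (x + c * t) * sin (phase (x, t)) * sgauss a c T (x, t) =
    gau 0 T^-1 t * xsingau (- (c * t)) a^-1 ((t - 0) * (tau - c * xi) + th) xi x.
  by rewrite sgaussE ?gt_eqF// phaseE /xsingau opprK; ring.
rewrite Rintegral_iterated.
- under eq_Rintegral => t _.
    under eq_Rintegral => x _ do rewrite /= E.
    rewrite RintegralZl//; last exact: integrable_xsingau.
    rewrite Rintegral_xsingau// Rintegral_cosgau//.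
    rewrite [X in _ * X](_ : _ = cos ((t - 0) * (tau - c * xi) + th) *
       (a^-1 * Num.sqrt (2 * pi) * (xi / a ^+ 2) * expR (- (a^-1 * xi) ^+ 2 / 2))); last first.
      by rewrite -exprVn; ring.
    rewrite mulrA [gau _ _ _ * _]mulrC.
    over.
  rewrite RintegralZr//; last exact: (integrable_cosgau 0 T10 th (tau - c * xi)).
  by rewrite (Rintegral_cosgau 0 T10 th (tau - c * xi)) mulrC -KE.
- apply: (@integrable_le_sgauss a c T 0 1) => //.
    by apply: meas_mul; [rewrite /phase; meas|exact: measurable_sgauss].
  move=> z; rewrite add0r mul1r !normrM (ger0_norm (sgauss_ge0 _ _ _ _)).
  by rewrite ler_wpM2r ?sgauss_ge0// ler_piMr// sin_max.
- move=> t; rewrite (_ : _ \o _ = EFin \o (fun x => gau 0 T^-1 t *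
    xsingau (- (c * t)) a^-1 ((t - 0) * (tau - c * xi) + th) xi x)).
    exact: (integrableZl measurableT _ (integrable_xsingau _ a10 _ _)).
  by apply/funext => x /=; rewrite E.
Qed.

End sgauss_fourier.

(** * Norms of wave packets *)

Section wave_packets.
Local Open Scope classical_set_scope.
Local Open Scope complex_scope.
Local Open Scope ring_scope.
Context {R : realType}.
Notation mu2 := (@lebesgue2 R).
Notation normc := ComplexField.Normc.normc.
Implicit Types (a c T p q b s alpha : R) (z zeta : R * R).

Definition wave p q a c T z : R[i] :=
  (cos (p * z.1 + q * z.2) * sgauss a c T z) +i*
  (sin (p * z.1 + q * z.2) * sgauss a c T z).

Lemma ctame_wave p q a c T : ctame a c T p q (wave p q a c T).
Proof.
split=> /=.
  rewrite (_ : (fun z => _) = packet a c T p q 1 0 0 0).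
    exact: tame_packet.
  by apply/funext => z; rewrite /packet !expr0 !mul1r addr0.
rewrite (_ : (fun z => _) = packet a c T p q 1 0 0 (- (pi / 2))).
  exact: tame_packet.
by apply/funext => z; rewrite /packet !expr0 !mul1r cosBpihalf.
Qed.

Lemma schwartz_wave p q a c T : 0 < a -> 0 < T -> schwartz (wave p q a c T).
Proof. by move=> a0 T0; exact: (ctame_schwartz a0 T0 (ctame_wave p q a c T)). Qed.

(** Opposite carriers cancel: the product sits at frequency zero, where its
    spectrum is the autocorrelation of the factors' spectra. *)
Lemma wave_mul_conj p q a c T z :
  wave p q a c T z * wave (- p) (- q) a c T z =
  (sgauss (Num.sqrt 2 * a) c (Num.sqrt 2 * T) z)%:C.
Proof.
have E : sgauss (Num.sqrt 2 * a) c (Num.sqrt 2 * T) z = sgauss a c T z * sgauss a c T z.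
  rewrite /sgauss -expRD; congr expR.
  have /= h2 : Num.sqrt 2 ^+ 2 = 2 :> R by rewrite sqr_sqrtr.
  have e (x y : R) : (Num.sqrt 2 * x * y) ^+ 2 = 2 * (x * y) ^+ 2.
    by rewrite -[X in _ = X * _]h2; ring.
  by rewrite !e; lra.
have /= H := cos2Dsin2 (p * z.1 + q * z.2).
rewrite /wave !mulNr -opprD cosN sinN E; simpc.
apply/eqP; rewrite eq_complex /=; apply/andP; split; apply/eqP; last by ring.
by rewrite -[RHS]mul1r -H; ring.
Qed.

(** A Gaussian adapted to the parallelogram [|xi - p| <= a],
    [|tau - q - c (xi - p)| <= T]. *)
Definition spectrum a c T p q zeta : R :=
  expR (- (((zeta.1 - p) / a) ^+ 2 + ((zeta.2 - q - c * (zeta.1 - p)) / T) ^+ 2) / 2).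

Lemma fourier_wave p q a c T zeta : 0 < a -> 0 < T ->
  fourier (wave p q a c T) zeta = (2 * pi / (a * T) * spectrum a c T p q zeta)%:C.
Proof.
move=> a0 T0; rewrite /fourier /cintegral.
have E z : expi (- (z.1 * zeta.1)) * expi (- (z.2 * zeta.2)) * wave p q a c T z =
  (cos (phase (zeta.1 - p) (zeta.2 - q) 0 z) * sgauss a c T z) +i*
  (cos (phase (zeta.1 - p) (zeta.2 - q) (pi / 2) z) * sgauss a c T z).
  rewrite /phase cosDpihalf addr0 /wave /expi.
  have -> : z.1 * (zeta.1 - p) + z.2 * (zeta.2 - q) =
    z.1 * zeta.1 + z.2 * zeta.2 - (p * z.1 + q * z.2) by ring.
  rewrite cosB sinB !cosD !sinD !cosN !sinN; simpc.
  by apply/eqP; rewrite eq_complex /=; apply/andP; split; apply/eqP; ring.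
under eq_Rintegral do rewrite E /=.
under [X in _ +i* X]eq_Rintegral do rewrite E /=.
rewrite !Rintegral_cos_sgauss// cos0 cos_pihalf mul1r !mul0r.
by rewrite /spectrum.
Qed.

(** The factor [i xi] of the derivative comes out of the sine integral, without
    integrating by parts in the plane. *)
Lemma fourier_derivative_sgauss a c T zeta : 0 < a -> 0 < T ->
  fourier (partial_x (fun z => (sgauss a c T z)%:C)) zeta =
  0 +i* (zeta.1 * (2 * pi / (a * T) * spectrum a c T 0 0 zeta)).
Proof.
move=> a0 T0; rewrite /fourier /cintegral.
have D z : partial_x (fun z => (sgauss a c T z)%:C) z =
    (- a ^+ 2 * (z.1 + c * z.2) * sgauss a c T z)%:C.
  case: z => x t; rewrite /partial_x /= derive1_cst derive1E; congr (_ +i* _).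
  apply: derive_val.
  by rewrite /sgauss /=; isd => /=; field.
have E z : expi (- (z.1 * zeta.1)) * expi (- (z.2 * zeta.2)) *
    partial_x (fun z => (sgauss a c T z)%:C) z =
  (a ^+ 2 * ((z.1 + c * z.2) * sin (phase zeta.1 zeta.2 (- (pi / 2)) z) * sgauss a c T z)) +i*
  (a ^+ 2 * ((z.1 + c * z.2) * sin (phase zeta.1 zeta.2 0 z) * sgauss a c T z)).
  rewrite D /phase sinBpihalf addr0 /expi.
  rewrite !cosD !sinD !cosN !sinN; simpc.
  by apply/eqP; rewrite eq_complex /=; apply/andP; split; apply/eqP; ring.
have I th : mu2.-integrable setT (EFin \o (fun z =>
    (z.1 + c * z.2) * sin (phase zeta.1 zeta.2 th z) * sgauss a c T z)).
  apply: (@integrable_le_sgauss _ a c T 0 1) => //.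
    by apply: meas_mul; [rewrite /phase; meas|exact: measurable_sgauss].
  move=> z; rewrite add0r mul1r !normrM (ger0_norm (sgauss_ge0 _ _ _ _)).
  by rewrite ler_wpM2r ?sgauss_ge0// ler_piMr// sin_max.
under eq_Rintegral do rewrite E /=.
under [X in _ +i* X]eq_Rintegral do rewrite E /=.
rewrite !RintegralZl// !Rintegral_shear_sin_sgauss// cos0 cosN cos_pihalf !mul0r !mulr0.
congr (_ +i* _); rewrite /spectrum !subr0; field.
by rewrite !gt_eqF.
Qed.

Lemma measurable_spectrum a c T p q : measurable_fun setT (spectrum a c T p q).
Proof. by rewrite /spectrum; meas. Qed.

Lemma integral_spectrum a c T p q : 0 < a -> 0 < T ->
  (\int[mu2]_z (spectrum a c T p q z)%:E = (2 * pi * (a * T))%:E)%E.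
Proof.
move=> a0 T0; rewrite /lebesgue2 fubini_tonelli1//=; last 2 first.
- by apply/measurable_EFinP; exact: measurable_spectrum.
- by move=> z; rewrite lee_fin expR_ge0.
rewrite /fubini_F.
have E x y : spectrum a c T p q (x, y) = gau p a x * gau (q + c * (x - p)) T y.
  by rewrite /spectrum /gau -expRD /=; congr expR; rewrite (opprD q) addrA; lra.
under eq_integral => x _.
  under eq_integral => y _ do rewrite E EFinM.
  rewrite ge0_integralZl//=; last 3 first.
  - by apply/measurable_EFinP; rewrite /gau; meas.
  - by move=> y _; rewrite lee_fin gau_ge0.
  - by rewrite lee_fin gau_ge0.
  rewrite integral_gau//.
  over.
rewrite ge0_integralZr//=; last 3 first.
- by apply/measurable_EFinP; rewrite /gau; meas.
- by move=> x _; rewrite lee_fin gau_ge0.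
- by rewrite lee_fin mulr_ge0 ?(ltW T0).
rewrite integral_gau// -EFinM; congr EFin.
rewrite mulrACA -expr2 sqr_sqrtr; last by rewrite mulr_ge0 ?pi_ge0.
by rewrite mulrC.
Qed.

Lemma measurable_Xweight b s alpha : measurable_fun setT (Xweight b s alpha).
Proof. by rewrite /Xweight /japanese /=; meas. Qed.

(** The phase of the Fourier transform is irrelevant to the norm, so that a real
    function with the same modulus may replace it. *)
Lemma XnormE b s alpha (u : R * R -> R[i]) (g : R * R -> R) :
  (forall zeta, normc (fourier u zeta) = `|g zeta|) ->
  Xnorm b s alpha u =
  ((\int[mu2]_zeta ((Xweight b s alpha zeta * g zeta) ^+ 2)%:E) `^ 2^-1)%E.
Proof.
move=> ug; rewrite /Xnorm unlock; congr (_ `^ _)%E; apply: eq_integral => zeta _.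
have N0 (w : R[i]) : 0 <= normc w by case: w => x y; rewrite sqrtr_ge0.
rewrite /comp abse_EFin poweR_EFin ger0_norm ?N0//.
rewrite Normc.normcM ug /= expr0n addr0 sqrtr_sqr -normrM powR_mulrn//.
by rewrite real_normK ?num_real.
Qed.

(** One of the two factors [spectrum] in the squared norm pays for the growth of
    the weight, the other one is integrated. *)
Lemma Xnorm_wave_le b s alpha p q a c T (B : R) : 0 < a -> 0 < T -> 0 <= B ->
  (forall zeta, Xweight b s alpha zeta ^+ 2 * spectrum a c T p q zeta <= B) ->
  (Xnorm b s alpha (wave p q a c T) <=
     (Num.sqrt ((2 * pi) ^+ 3 * B / (a * T)))%:E)%E.
Proof.
move=> a0 T0 B0 wB.
rewrite (@XnormE _ _ _ _ (fun zeta => 2 * pi / (a * T) * spectrum a c T p q zeta)).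
  rewrite -powR12_sqrt; last first.
    by rewrite !(mulr_ge0, invr_ge0, exprn_ge0) ?pi_ge0// ltW.
  rewrite -poweR_EFin; apply: gt0_ler_poweR => //.
  - by rewrite in_itv /= leey andbT integral_ge0// => z _; rewrite lee_fin sqr_ge0.
  - rewrite in_itv /= leey andbT lee_fin.
    by rewrite !(mulr_ge0, invr_ge0, exprn_ge0) ?pi_ge0// ltW.
  pose k := (2 * pi / (a * T)) ^+ 2 * B.
  have k0 : 0 <= k by rewrite mulr_ge0 ?sqr_ge0.
  have -> : (2 * pi) ^+ 3 * B / (a * T) = k * (2 * pi * (a * T)).
    by rewrite /k; field; rewrite !gt_eqF.
  rewrite EFinM -(integral_spectrum c p q a0 T0) -ge0_integralZl//=; last 2 first.
  - by apply/measurable_EFinP; exact: measurable_spectrum.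
  - by move=> z _; rewrite lee_fin expR_ge0.
  apply: ge0_le_integral => //=.
  - by move=> z _; rewrite lee_fin sqr_ge0.
  - apply/measurable_EFinP/meas_exp/meas_mul; first exact: measurable_Xweight.
    by apply: meas_mul; [exact: meas_cst|exact: measurable_spectrum].
  - apply/measurable_EFinP/meas_mul; first exact: meas_cst.
    exact: measurable_spectrum.
  - move=> z _; rewrite lee_fin.
    rewrite [leLHS](_ : _ = (2 * pi / (a * T)) ^+ 2 * (Xweight b s alpha z ^+ 2 *
      spectrum a c T p q z) * spectrum a c T p q z); last by ring.
    rewrite ler_wpM2r ?expR_ge0// /k ler_wpM2l ?sqr_ge0//.
move=> zeta; rewrite fourier_wave//= expr0n addr0 sqrtr_sqr//.
Qed.

(** Where the spectrum of the product of two packets is bounded below. The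
    frequencies stay away from zero because of the derivative. *)
Definition sheared_box a c T z : R :=
  \1_(`[a, 2 * a]%classic) z.1 * \1_(`[- T, T]%classic) (z.2 - c * z.1).

Lemma measurable_sheared_box a c T : measurable_fun setT (sheared_box a c T).
Proof.
apply: meas_mul.
  exact: (measurableT_comp (f := \1_(`[a, 2 * a]%classic) : R -> R)).
apply: (measurableT_comp (f := \1_(`[- T, T]%classic) : R -> R)) => //.
by meas.
Qed.

Lemma sheared_box_ge0 a c T z : 0 <= sheared_box a c T z.
Proof. by rewrite mulr_ge0. Qed.

Lemma integral_sheared_box a c T : 0 < a -> 0 < T ->
  (\int[mu2]_z (sheared_box a c T z)%:E = (a * (2 * T))%:E)%E.
Proof.
move=> a0 T0; rewrite /lebesgue2 fubini_tonelli1//=; last 2 first.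
- by apply/measurable_EFinP; exact: measurable_sheared_box.
- by move=> z; rewrite lee_fin sheared_box_ge0.
rewrite /fubini_F.
have E x y : sheared_box a c T (x, y) =
    \1_(`[a, 2 * a]%classic) x * \1_(`[c * x - T, c * x + T]%classic) y.
  rewrite /sheared_box /= !indicE; congr (_ * (_%:R)); congr (nat_of_bool _).
  apply/idP/idP; rewrite !inE /= !in_itv /= => /andP[h1 h2]; apply/andP; split; lra.
under eq_integral => x _.
  under eq_integral => y _ do rewrite E EFinM.
  rewrite ge0_integralZl//=; last first.
    by apply/measurable_EFinP; exact: measurable_indic.
  rewrite integral_indic//= setIT lebesgue_measure_itv/= lte_fin.
  have -> : (c * x - T < c * x + T) by lra.
  rewrite -EFinB.
  have -> : c * x + T - (c * x - T) = 2 * T by lra.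
  over.
rewrite ge0_integralZr//=; last 2 first.
- by apply/measurable_EFinP; exact: measurable_indic.
- by rewrite lee_fin mulr_ge0// ltW.
rewrite integral_indic//= setIT lebesgue_measure_itv/= lte_fin.
have -> : (a < 2 * a) by lra.
by rewrite -EFinB -EFinM; congr EFin; lra.
Qed.

(** The widths [sqrt 2 * a] and [sqrt 2 * T] are those of the square of a
    packet. On the box the exponent of the squared spectrum is at least
    [- (2 + 1 / 2)]. *)
Lemma Xnorm_derivative_sgauss_ge b s alpha a c T (B : R) : 0 < a -> 0 < T -> 0 <= B ->
  (forall zeta, a <= zeta.1 <= 2 * a -> - T <= zeta.2 - c * zeta.1 <= T ->
     B <= Xweight b s alpha zeta ^+ 2) ->
  ((Num.sqrt (2 * pi ^+ 2 * expR (- (5 / 2)) * B * a / T))%:E <=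
   Xnorm b s alpha
     (partial_x (fun z => (sgauss (Num.sqrt 2 * a) c (Num.sqrt 2 * T) z)%:C)))%E.
Proof.
move=> a0 T0 B0 wB.
have s2 : 0 < Num.sqrt 2 :> R by rewrite sqrtr_gt0.
have /= h2 : Num.sqrt 2 ^+ 2 = 2 :> R by rewrite sqr_sqrtr.
have a2 : 0 < Num.sqrt 2 * a by rewrite mulr_gt0.
have T2 : 0 < Num.sqrt 2 * T by rewrite mulr_gt0.
pose g zeta := zeta.1 * (2 * pi / (Num.sqrt 2 * a * (Num.sqrt 2 * T)) *
  spectrum (Num.sqrt 2 * a) c (Num.sqrt 2 * T) 0 0 zeta).
have k0 : 0 <= 2 * pi ^+ 2 * expR (- (5 / 2)) * B * a / T.
  by rewrite !(mulr_ge0, invr_ge0, exprn_ge0) ?pi_ge0 ?expR_ge0// ltW.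
rewrite (@XnormE _ _ _ _ g).
  rewrite -powR12_sqrt// -poweR_EFin; apply: gt0_ler_poweR => //.
  - by rewrite in_itv /= leey andbT lee_fin.
  - by rewrite in_itv /= leey andbT integral_ge0// => z _; rewrite lee_fin sqr_ge0.
  pose k := (pi / (a * T)) ^+ 2 * expR (- (5 / 2)) * B * a ^+ 2.
  have k0' : 0 <= k.
    by rewrite !(mulr_ge0, invr_ge0, exprn_ge0) ?pi_ge0 ?expR_ge0// ltW.
  have -> : 2 * pi ^+ 2 * expR (- (5 / 2)) * B * a / T = k * (a * (2 * T)).
    by rewrite /k; field; rewrite !gt_eqF.
  rewrite EFinM -(integral_sheared_box c a0 T0) -ge0_integralZl//=; last 2 first.
  - by apply/measurable_EFinP; exact: measurable_sheared_box.
  - by move=> z _; rewrite lee_fin sheared_box_ge0.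
  apply: ge0_le_integral => //=.
  - by move=> z _; rewrite lee_fin mulr_ge0 ?sheared_box_ge0.
  - apply/measurable_EFinP/meas_mul; first exact: meas_cst.
    exact: measurable_sheared_box.
  - apply/measurable_EFinP/meas_exp/meas_mul; first exact: measurable_Xweight.
    apply: meas_mul; first exact: measurable_fst.
    by apply: meas_mul; [exact: meas_cst|exact: measurable_spectrum].
  - move=> z _; rewrite lee_fin /sheared_box !indicE.
    case: (boolP (z.1 \in _)) => [|_]; last by rewrite mul0r mulr0 sqr_ge0.
    case: (boolP (_ - _ \in _)) => [|_]; last by rewrite !mulr0 sqr_ge0.
    rewrite !inE /= !in_itv /= => hT h; rewrite !mulr1.
    have Bw := wB _ h hT.
    have -> : (Xweight b s alpha z * g z) ^+ 2 = (pi / (a * T)) ^+ 2 *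
      (spectrum (Num.sqrt 2 * a) c (Num.sqrt 2 * T) 0 0 z) ^+ 2 *
      Xweight b s alpha z ^+ 2 * z.1 ^+ 2.
      rewrite /g.
      have -> : Num.sqrt 2 * a * (Num.sqrt 2 * T) = 2 * (a * T) by rewrite -[X in _ = X * _]h2; ring.
      by rewrite -[2 * pi / _]mulrA invfM; field; rewrite !gt_eqF.
    case/andP: h => h h'; case/andP: hT => hT hT'.
    have le1 : a ^+ 2 <= z.1 ^+ 2 by rewrite ler_sqr ?nnegrE ?(ltW a0)// (le_trans (ltW a0)).
    have le2 : expR (- (5 / 2)) <= spectrum (Num.sqrt 2 * a) c (Num.sqrt 2 * T) 0 0 z ^+ 2.
      rewrite /spectrum -expRM_natl ler_expR !subr0 !expr_div_n !exprMn h2.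
      have q1 : z.1 ^+ 2 / (2 * a ^+ 2) <= 2.
        rewrite ler_pdivrMr ?mulr_gt0 ?exprn_gt0//.
        have : z.1 ^+ 2 <= (2 * a) ^+ 2 by rewrite ler_sqr ?nnegrE ?mulr_ge0 ?(ltW a0)// (le_trans (ltW a0)).
        by rewrite exprMn; lra.
      have q2 : (z.2 - c * z.1) ^+ 2 / (2 * T ^+ 2) <= 1 / 2.
        rewrite ler_pdivrMr ?mulr_gt0 ?exprn_gt0//.
        have : (z.2 - c * z.1) ^+ 2 <= T ^+ 2.
          by rewrite -[leLHS]real_normK ?num_real// ler_sqr ?nnegrE ?(ltW T0)// ler_norml hT hT'.
        lra.
      lra.
    have p0 : 0 <= (pi / (a * T)) ^+ 2 := sqr_ge0 _.
    have e0 := expR_ge0 (- (5 / 2) : R).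
    rewrite /k; apply: ler_pM => //; [|exact: sqr_ge0|].
      by apply: mulr_ge0 => //; exact: mulr_ge0.
    by apply: ler_pM => //; [exact: mulr_ge0|exact: ler_wpM2l].
move=> zeta; rewrite fourier_derivative_sgauss// /= expr0n add0r sqrtr_sqr//.
Qed.

End wave_packets.

(** * The weight along the dispersion curve *)

Section weights.
Context {R : realType}.
Implicit Types (a c T N M b s alpha r x y : R) (zeta : R * R).

Lemma japanese_le (w : R[i]) :
  japanese w <= 1 + `|complex.Re w| + `|complex.Im w|.
Proof.
case: w => x y; rewrite /japanese /= sqr_sqrtr ?addr_ge0 ?sqr_ge0//.
rewrite -[leRHS]ger0_norm ?addr_ge0// -sqrtr_sqr ler_wsqrtr//.
rewrite -[x ^+ 2]real_normK ?num_real// -[y ^+ 2]real_normK ?num_real//.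
have := normr_ge0 x; have := normr_ge0 y; nra.
Qed.

Lemma japanese_ge1 (w : R[i]) : 1 <= japanese w.
Proof. by rewrite -[leLHS]sqrtr1 /japanese ler_wsqrtr// lerDl sqr_ge0. Qed.

Lemma japanese_real_ge x : `|x| <= japanese x%:C%C.
Proof.
rewrite /japanese /= expr0n addr0 sqrtr_sqr real_normK ?num_real//.
by rewrite -[leLHS]sqrtr_sqr ler_wsqrtr// lerDr.
Qed.

Lemma Xweight_sqr b s alpha zeta : Xweight b s alpha zeta ^+ 2 =
  japanese ((`|zeta.1| `^ (2 * alpha)) +i* (zeta.2 - zeta.1 ^+ 3))%C `^ (2 * b)
  * japanese zeta.1%:C%C `^ (2 * s).
Proof.
have sq x y : (x `^ y) ^+ 2 = x `^ (2 * y) by rewrite -powR_mulrn ?powR_ge0// -powRrM mulrC.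
by rewrite /Xweight exprMn !sq.
Qed.

Lemma eq_ler x y : x = y -> x <= y. Proof. by move=> ->. Qed.

(** [1 + y^2 <= exp (q (1 + y^2)) / q] for every positive [q]; taking
    [q = 1 / (8 r)] leaves the rate [1 / 4] after raising to the power [2 r]. *)
Lemma powR_le_gaussian r : 0 < r ->
  exists2 K : R, 0 < K & forall y, (1 + y ^+ 2) `^ (2 * r) <= K * expR (y ^+ 2 / 4).
Proof.
move=> r0; pose q := (8 * r)^-1.
have q0 : 0 < q by rewrite invr_gt0 mulr_gt0.
exists (q^-1 `^ (2 * r) * expR (1 / 4)).
  by apply: mulr_gt0; [apply: powR_gt0; rewrite invr_gt0|exact: expR_gt0].
move=> y.
have y0 : 0 <= 1 + y ^+ 2 by rewrite addr_ge0 ?sqr_ge0.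
have q1 : 0 <= q^-1 by rewrite invr_ge0 ltW.
have h : 1 + y ^+ 2 <= q^-1 * expR (q * (1 + y ^+ 2)).
  by rewrite ler_pdivlMl//; apply: le_trans (expR_ge1Dx _); rewrite lerDr.
apply: (@le_trans _ _ ((q^-1 * expR (q * (1 + y ^+ 2))) `^ (2 * r))).
  apply: ge0_ler_powR => //; first by rewrite mulr_ge0 ?(ltW r0).
  by rewrite nnegrE; apply: mulr_ge0 => //; exact: expR_ge0.
rewrite powRM ?expR_ge0// -expRM -mulrA -expRD ler_wpM2l ?powR_ge0//.
by rewrite ler_expR /q; apply: eq_ler; field; rewrite gt_eqF.
Qed.

(** The polynomial is the bound on the weight of [dispersive_weight_le], with [y]
    and [y'] the moduli of the coordinates along and across the parallelogram.
    Half of the available Gaussian is kept for the factor coming from [s]. *)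
Lemma polynomial_le_gaussian y y' :
  1 + (1 + y) ^+ 2 + 3 * y ^+ 2 + y ^+ 3 + y' <=
  42 * (expR (y ^+ 2 / 4) * expR (y' ^+ 2 / 4)).
Proof.
have h0 : 1 <= expR (y ^+ 2 / 4).
  by rewrite -[leLHS]expR0 ler_expR divr_ge0 ?sqr_ge0.
have h0' : 1 <= expR (y' ^+ 2 / 4).
  by rewrite -[leLHS]expR0 ler_expR divr_ge0 ?sqr_ge0.
have h1 : 1 + y ^+ 2 / 4 <= expR (y ^+ 2 / 4) by exact: expR_ge1Dx.
have h1' : 1 + y' ^+ 2 / 4 <= expR (y' ^+ 2 / 4) by exact: expR_ge1Dx.
have h2 : 1 + (y ^+ 2 / 4) ^+ 2 / 2 <= expR (y ^+ 2 / 4).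
  by apply: (@expR_ge1Dxn _ _ 1); rewrite divr_ge0 ?sqr_ge0.
have h3 : y' <= expR (y' ^+ 2 / 4).
  by apply: le_trans h1'; have := sqr_ge0 (y' - 2); rewrite sqrrB; lra.
have h4 : 1 + (1 + y) ^+ 2 + 3 * y ^+ 2 + y ^+ 3 <= 41 * expR (y ^+ 2 / 4).
  have -> : y ^+ 3 = y * y ^+ 2 by ring.
  have : y * y ^+ 2 <= (y ^+ 2 + (y ^+ 2) ^+ 2) / 2.
    by have := sqr_ge0 (y ^+ 2 - y); rewrite sqrrB; lra.
  have := sqr_ge0 (y - 1); rewrite sqrrB sqrrD expr_div_n in h2 *; lra.
move: h0 h0' h3 h4; set E := expR _; set E' := expR _ => h0 h0' h3 h4; nra.
Qed.

(** With [T = N a^2], the tangent to the cubic at [N] stays within a multiple of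
    [T] of the curve over the length [a], and [T = N^(2 alpha)] is the size of
    the dissipation at frequency [N]. *)
Section packet_weight.
Variables (alpha N a T : R).
Hypothesis alpha0 : 0 < alpha.
Hypothesis alpha1 : alpha <= 1.
Hypothesis N1 : 1 <= N.
Hypothesis a0 : 0 < a.
Hypothesis TE : T = N * a ^+ 2.
Hypothesis T1 : 1 <= T.
Hypothesis TN : T = N `^ (2 * alpha).
Hypothesis aN : a ^+ 2 <= N.

Let N0 : 0 < N. Proof. exact: lt_le_trans N1. Qed.
Let T0 : 0 < T. Proof. exact: lt_le_trans T1. Qed.
Let aleN : a <= N. Proof. have := aN; have := N1; have := a0; nra. Qed.

(** Expanding the cube around [M], the linear term is the tangent and drops out,
    the quadratic term is [3 N a^2 eta^2 = 3 T eta^2], and the cubic one is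
    smaller since [a <= N]. *)
Lemma dispersive_weight_le M zeta (eta := (zeta.1 - M) / a)
    (sig := (zeta.2 - M ^+ 3 - 3 * N ^+ 2 * (zeta.1 - M)) / T) : `|M| = N ->
  japanese ((`|zeta.1| `^ (2 * alpha)) +i* (zeta.2 - zeta.1 ^+ 3))%C <=
  42 * T * (expR (eta ^+ 2 / 4) * expR (sig ^+ 2 / 4)).
Proof.
move=> MN; apply: le_trans (japanese_le _) _; rewrite /=.
have xE : zeta.1 = M + a * eta by rewrite /eta; field; rewrite gt_eqF.
have M2 : M ^+ 2 = N ^+ 2 by rewrite -MN real_normK ?num_real.
have imE : zeta.2 - zeta.1 ^+ 3 = T * sig - 3 * M * a ^+ 2 * eta ^+ 2 - a ^+ 3 * eta ^+ 3.
  rewrite /sig -M2 {2}xE /eta; field; by rewrite !gt_eqF.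
clearbody eta sig.
have a3 : a ^+ 3 <= T by rewrite TE (exprS a 2) ler_wpM2r ?sqr_ge0.
have y0 := normr_ge0 eta.
have y3 : 0 <= `|eta| ^+ 3 by rewrite exprn_ge0.
have im : `|zeta.2 - zeta.1 ^+ 3| <= T * (`|sig| + 3 * `|eta| ^+ 2 + `|eta| ^+ 3).
  rewrite imE; apply: le_trans (ler_normB _ _) _.
  apply: le_trans (lerD (ler_normB _ _) (lexx _)) _.
  rewrite (normrM T) (normrM (3 * M * a ^+ 2)) (normrM (3 * M)) (normrM 3) (normrM (a ^+ 3)).
  rewrite !normrX MN (gtr0_norm T0) (gtr0_norm a0) normr_nat.
  have : a ^+ 3 * `|eta| ^+ 3 <= T * `|eta| ^+ 3 by rewrite ler_wpM2r.
  have -> : 3 * N * a ^+ 2 * `|eta| ^+ 2 = 3 * (T * `|eta| ^+ 2) by rewrite TE; ring.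
  lra.
have re : `| `|zeta.1| `^ (2 * alpha)| <= T * (1 + `|eta|) ^+ 2.
  rewrite ger0_norm ?powR_ge0// TN.
  have xle : `|zeta.1| <= N * (1 + `|eta|).
    rewrite xE; apply: le_trans (ler_normD _ _) _; rewrite MN normrM (gtr0_norm a0) mulrDr mulr1.
    by rewrite lerD2l ler_wpM2r.
  apply: (@le_trans _ _ ((N * (1 + `|eta|)) `^ (2 * alpha))).
    apply: ge0_ler_powR => //; first by rewrite mulr_ge0 ?(ltW alpha0).
    by rewrite nnegrE mulr_ge0 ?(ltW N0)// addr_ge0.
  rewrite powRM ?(ltW N0) ?addr_ge0// ler_wpM2l ?powR_ge0//.
  rewrite -powR_mulrn ?addr_ge0//; apply: ler_powR; first by rewrite lerDl.
  by rewrite -[leRHS]mulr1 ler_wpM2l.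
have := polynomial_le_gaussian `|eta| `|sig|.
rewrite !real_normK ?num_real// => P.
have := ler_wpM2l (ltW T0) P.
move: im re T1; rewrite !real_normK ?num_real//; set E := expR _ * expR _; lra.
Qed.

(** Either [xi] is comparable to [N], or [a |eta| >= N / 2], and then
    [eta^2 >= N / 4] because [a^2 <= N]. *)
Lemma frequency_le M xi : `|M| = N ->
  N <= 4 * (japanese xi%:C%C * (1 + ((xi - M) / a) ^+ 2)).
Proof.
move=> MN; set eta := (xi - M) / a.
have xE : M = xi - a * eta by rewrite /eta; field; rewrite gt_eqF.
clearbody eta.
have j1 := japanese_ge1 xi%:C%C; have jx := japanese_real_ge xi.
have h : N <= `|xi| + a * `|eta|.
  by rewrite -MN xE; apply: le_trans (ler_normB _ _) _; rewrite normrM (gtr0_norm a0).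
have e0 : 0 <= eta ^+ 2 by exact: sqr_ge0.
have [le|gt] := leP (a * `|eta|) (N / 2).
  have : 0 <= (japanese xi%:C%C) * eta ^+ 2 by rewrite mulr_ge0// (le_trans _ j1).
  lra.
have h2 : N ^+ 2 <= 4 * (N * eta ^+ 2).
  have : (N / 2) ^+ 2 <= (a * `|eta|) ^+ 2.
    by rewrite ler_sqr ?nnegrE ?mulr_ge0 ?(ltW gt) ?(ltW a0) ?divr_ge0 ?(ltW N0).
  rewrite !exprMn real_normK ?num_real// => h2.
  have := ler_wpM2r e0 aN; lra.
have h3 : N <= 4 * eta ^+ 2.
  by rewrite -(ler_pM2l N0) -expr2 (le_trans h2)// mulrCA.
nra.
Qed.

(** For negative regularity the weight is largest at low frequencies, where the
    Gaussian tail of the spectrum compensates by [frequency_le]. *)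
Lemma Xweight_spectrum_le r K M : 0 < r ->
  (forall y, (1 + y ^+ 2) `^ (2 * r) <= K * expR (y ^+ 2 / 4)) -> `|M| = N ->
  forall zeta,
  Xweight (1 / 2) (- r) alpha zeta ^+ 2 * spectrum a (3 * N ^+ 2) T M (M ^+ 3) zeta <=
  42 * 4 `^ (2 * r) * K * T * N `^ (2 * - r).
Proof.
move=> r0 HK MN zeta.
have disp := dispersive_weight_le zeta MN.
have freq := frequency_le zeta.1 MN.
rewrite Xweight_sqr /spectrum.
have -> : 2 * (1 / 2) = 1 :> R by lra.
rewrite powRr1; last by rewrite (le_trans _ (japanese_ge1 _)).
move: disp freq.
set eta := (_ / a); set sig := (_ / T); set J := japanese (_ +i* _)%C.
set j := japanese _; move=> disp freq.
have J0 : 0 <= J by rewrite (le_trans _ (japanese_ge1 _)).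
have j0 : 0 < j by rewrite (lt_le_trans _ (japanese_ge1 _)).
have e0 : 0 < 1 + eta ^+ 2 by rewrite ltr_wpDr ?sqr_ge0.
have jle : j `^ (2 * - r) <= 4 `^ (2 * r) * N `^ (2 * - r) * (K * expR (eta ^+ 2 / 4)).
  rewrite !mulrN !powRN.
  have h : N `^ (2 * r) <= 4 `^ (2 * r) * (j `^ (2 * r) * (1 + eta ^+ 2) `^ (2 * r)).
    rewrite -!powRM ?mulr_ge0 ?(ltW j0) ?(ltW e0)//.
    apply: ge0_ler_powR => //; first by rewrite mulr_ge0 ?(ltW r0).
      by rewrite nnegrE ltW.
    by rewrite nnegrE !mulr_ge0 ?(ltW j0) ?(ltW e0).
  have jr : 0 < j `^ (2 * r) by rewrite powR_gt0.
  have Nr : 0 < N `^ (2 * r) by rewrite powR_gt0.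
  apply: (@le_trans _ _ (4 `^ (2 * r) / N `^ (2 * r) * (1 + eta ^+ 2) `^ (2 * r))); last first.
    by rewrite ler_wpM2l ?HK// divr_ge0 ?powR_ge0.
  rewrite -[leRHS]mulrAC ler_pdivlMr// mulrC ler_pdivrMr//.
  by rewrite -mulrA [_ `^ _ * j `^ _]mulrC.
have E : expR (- (eta ^+ 2 + sig ^+ 2) / 2) =
   (expR (eta ^+ 2 / 4) * expR (sig ^+ 2 / 4) * expR (eta ^+ 2 / 4))^-1 * expR (- (sig ^+ 2 / 4)).
  by rewrite -!expRD -expRN -expRD; congr expR; lra.
have Jj := ler_pM J0 (powR_ge0 j (2 * - r)) disp jle.
apply: (@le_trans _ _ (J * j `^ (2 * - r) *
   (expR (eta ^+ 2 / 4) * expR (sig ^+ 2 / 4) * expR (eta ^+ 2 / 4))^-1)).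
  rewrite ler_wpM2l ?mulr_ge0 ?powR_ge0// E ler_piMr ?invr_ge0 ?mulr_ge0 ?expR_ge0//.
  by rewrite -[leRHS]expR0 ler_expR oppr_le0 divr_ge0 ?sqr_ge0.
rewrite ler_pdivrMr ?mulr_gt0 ?expR_gt0//; apply: le_trans Jj _.
by apply: eq_ler; ring.
Qed.

(** At low frequency the distance to the cubic is at most of order [N^2 a]: the
    point follows the line of slope [3 N^2] through the origin. Both exponents
    are negative, so that upper bounds on the brackets give a lower bound. *)
Lemma Xweight_box_ge delta s m : 0 < delta -> delta < 1 / 2 -> s < 0 ->
  1 <= m -> a <= m -> forall zeta, a <= zeta.1 <= 2 * a ->
  - T <= zeta.2 - 3 * N ^+ 2 * zeta.1 <= T ->
  (21 * (N ^+ 2 * a)) `^ (2 * (- (1 / 2) + delta)) * (3 * m) `^ (2 * s) <=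
  Xweight (- (1 / 2) + delta) s alpha zeta ^+ 2.
Proof.
move=> d0 d1 s0 m1 am zeta /andP[x1 x2] /andP[t1 t2].
have antitone x y p : 0 < x -> x <= y -> p <= 0 -> y `^ p <= x `^ p.
  move=> x0 xy p0; rewrite -[p]opprK ![_ `^ (- - p)]powRN lef_pV2 ?posrE ?powR_gt0//; last first.
    exact: lt_le_trans xy.
  by apply: ge0_ler_powR; rewrite ?nnegrE ?oppr_ge0// ltW// (lt_le_trans x0).
rewrite Xweight_sqr; apply: ler_pM; rewrite ?powR_ge0//.
- apply: antitone; [exact: lt_le_trans (japanese_ge1 _)| |lra].
  apply: le_trans (japanese_le _) _; rewrite /=.
  have x0 : 0 < zeta.1 by exact: lt_le_trans x1.
  set Q := N ^+ 2 * a.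
  have TQ : T <= Q by rewrite TE /Q expr2 -mulrA ler_pM2l//; have := a0; have := aleN; nra.
  have a3Q : a ^+ 3 <= Q.
    by rewrite /Q (exprSr a 2) ler_wpM2r ?(ltW a0)// ler_sqr ?nnegrE ?(ltW a0) ?(ltW N0).
  have a2Q : a ^+ 2 <= Q.
    apply: le_trans TQ; rewrite TE; have := sqr_ge0 a; have := N1; nra.
  have Q1 : 1 <= Q by exact: le_trans TQ.
  have x3 : zeta.1 ^+ 3 <= 8 * a ^+ 3.
    have -> : 8 * a ^+ 3 = (2 * a) ^+ 3 by ring.
    by rewrite ler_pXn2r// nnegrE ?mulr_ge0 ?(ltW a0) ?(ltW x0).
  have x30 : 0 <= zeta.1 ^+ 3 by rewrite exprn_ge0// ltW.
  have xQ : N ^+ 2 * zeta.1 <= 2 * Q by rewrite /Q mulrCA ler_wpM2l ?sqr_ge0.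
  have xQ0 : 0 <= N ^+ 2 * zeta.1 by rewrite mulr_ge0 ?sqr_ge0 ?(ltW x0).
  have im : `|zeta.2 - zeta.1 ^+ 3| <= 15 * Q.
    by rewrite ler_norml; apply/andP; split; lra.
  have re : `| `|zeta.1| `^ (2 * alpha)| <= 1 + 4 * a ^+ 2.
    rewrite ger0_norm ?powR_ge0// (gtr0_norm x0).
    have [le1|gt1] := leP zeta.1 1.
      apply: (@le_trans _ _ 1); last by rewrite lerDl mulr_ge0 ?sqr_ge0.
      rewrite [leRHS](_ : 1 = 1 `^ (2 * alpha)); last by rewrite powR1.
      by apply: ge0_ler_powR; rewrite ?nnegrE ?mulr_ge0 ?(ltW x0) ?(ltW alpha0).
    apply: (@le_trans _ _ (zeta.1 ^+ 2)).
      rewrite -powR_mulrn ?(ltW x0)//; apply: ler_powR; first exact: ltW.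
      by rewrite -[leRHS]mulr1 ler_wpM2l.
    have : zeta.1 ^+ 2 <= (2 * a) ^+ 2 by rewrite ler_sqr ?nnegrE ?mulr_ge0 ?(ltW a0) ?(ltW x0).
    by rewrite exprMn; lra.
  lra.
- apply: antitone; [exact: lt_le_trans (japanese_ge1 _)| |lra].
  apply: le_trans (japanese_le _) _; rewrite /= normr0 addr0.
  rewrite ger0_norm; last by rewrite (le_trans (ltW a0)).
  lra.
Qed.

End packet_weight.
End weights.

(** * Failure of the bilinear estimate *)

Section failure.
Context {R : realType}.

Lemma s_crit_lt0 (alpha : R) : alpha <= 1 -> s_crit alpha < 0.
Proof.
move=> a1; rewrite /s_crit; case: ifP => _; rewrite oppr_lt0; first by lra.
by rewrite divr_gt0; lra.
Qed.

(** [max 0 (alpha - 1 / 2)] is the exponent of the output frequency scale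
    [max 1 a]. Equality holds at the critical regularity. *)
Lemma s_crit_exponent (alpha s : R) : alpha <= 1 -> s <= s_crit alpha ->
  0 <= 2 * s * Num.max 0 (alpha - 1 / 2) - 3 - 4 * s.
Proof.
move=> a1; rewrite /s_crit; case: ifP => [h|/negbT]; last rewrite -ltNge => h.
  by rewrite max_l; lra.
rewrite max_r; last by lra.
rewrite -mulNr ler_pdivlMr; lra.
Qed.

(** The estimate on the two packets at [N] and [- N] reads, after cancellation,
    [(N^2 a)^(2 delta) * N^(2 s beta - 3 - 4 s) <= K], and the second factor is
    at least one. *)
Lemma bilinear_estimate_bounds_powers (alpha s delta C : R) :
  0 < alpha -> alpha <= 1 -> s <= s_crit alpha -> 0 < delta -> delta < 1 / 2 -> 0 < C ->
  (forall u v : R * R -> R[i], schwartz u -> schwartz v ->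
    (Xnorm (- (1 / 2) + delta) s alpha (partial_x (fun z => (u z * v z)%R))
       <= C%:E * Xnorm (1 / 2) s alpha u * Xnorm (1 / 2) s alpha v)%E) ->
  exists K : R, forall N : R, 1 <= N -> N `^ (2 * delta) <= K.
Proof.
move=> alpha0 alpha1 sle d0 d1 C0 H.
have s0 : s < 0 by exact: le_lt_trans sle (s_crit_lt0 alpha1).
have exp0 := s_crit_exponent alpha1 sle.
set beta := Num.max 0 (alpha - 1 / 2) in exp0.
have beta0 : 0 <= beta by rewrite le_max lexx.
have betaa : alpha - 1 / 2 <= beta by rewrite le_max lexx orbT.
have r0 : 0 < - s by rewrite oppr_gt0.
have [K K0 HK] := powR_le_gaussian r0.
pose KB := 42 * 4 `^ (2 * - s) * K.
have KB0 : 0 <= KB by rewrite !mulr_ge0 ?powR_ge0 ?(ltW K0).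
pose k1 : R := 2 * pi ^+ 2 * expR (- (5 / 2)) *
  (21 `^ (2 * (- (1 / 2) + delta)) * 3 `^ (2 * s)).
have k10 : 0 < k1.
  by apply: mulr_gt0; [apply: mulr_gt0; rewrite ?expR_gt0// mulr_gt0 ?exprn_gt0 ?pi_gt0|
    apply: mulr_gt0; exact: powR_gt0].
pose k2 : R := (C * ((2 * pi) ^+ 3 * KB)) ^+ 2.
exists (k2 / k1) => N N1.
have N0 : 0 < N by exact: lt_le_trans N1.
pose a := N `^ (alpha - 1 / 2); pose T := N `^ (2 * alpha); pose m := N `^ beta.
have powD x y : N `^ (x + y) = N `^ x * N `^ y by rewrite powRD// (gt_eqF N0) implybT.
have a0 : 0 < a by exact: powR_gt0.
have T0 : 0 < T by exact: powR_gt0.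
have m1 : 1 <= m by rewrite -(powRr0 N); exact: ler_powR.
have am : a <= m by exact: ler_powR.
have TE : T = N * a ^+ 2.
  rewrite /T /a -powR_mulrn ?powR_ge0// -powRrM -{2}(powRr1 (ltW N0)) -powD.
  by congr (_ `^ _); lra.
have T1 : 1 <= T by rewrite -(powRr0 N); apply: ler_powR => //; rewrite mulr_ge0// ltW.
have aN : a ^+ 2 <= N.
  rewrite /a -powR_mulrn ?powR_ge0// -powRrM -[leRHS](powRr1 (ltW N0)).
  by apply: ler_powR => //; lra.
pose c := 3 * N ^+ 2.
pose B := KB * T * N `^ (2 * s).
have B0 : 0 <= B.
  by apply: mulr_ge0; [apply: mulr_ge0 => //; exact: ltW|exact: powR_ge0].
pose U := Num.sqrt ((2 * pi) ^+ 3 * B / (a * T)).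
have up M : `|M| = N ->
    (Xnorm (1 / 2) s alpha (wave M (M ^+ 3) a c T) <= U%:E)%E.
  move=> MN; apply: Xnorm_wave_le => // zeta.
  have := Xweight_spectrum_le alpha0 alpha1 N1 a0 TE T1 erefl aN r0 HK MN zeta.
  by rewrite !opprK.
pose B' := (21 * (N ^+ 2 * a)) `^ (2 * (- (1 / 2) + delta)) * (3 * m) `^ (2 * s).
have B'0 : 0 <= B' by rewrite mulr_ge0 ?powR_ge0.
have low := Xnorm_derivative_sgauss_ge a0 T0 B'0
  (Xweight_box_ge alpha0 alpha1 N1 a0 TE T1 aN d0 d1 s0 m1 am).
have := H _ _ (schwartz_wave N (N ^+ 3) c a0 T0) (schwartz_wave (- N) (- (N ^+ 3)) c a0 T0).
(* The product of the packets is a real Gaussian, to which [low] applies. *)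
rewrite (_ : (fun z => _) = (fun z => (sgauss (Num.sqrt 2 * a) c (Num.sqrt 2 * T) z)%:C%C)); last first.
  by apply/funext => z; rewrite wave_mul_conj.
move=> /(le_trans low) {}H.
have NN : (- N) ^+ 3 = - N ^+ 3 by ring.
have upm := up (- N); rewrite NN normrN gtr0_norm// in upm.
have upp := up N; rewrite gtr0_norm// in upp.
have U0 : 0 <= U by rewrite sqrtr_ge0.
have : ((Num.sqrt (2 * pi ^+ 2 * expR (- (5 / 2)) * B' * a / T))%:E <= (C * U * U)%:E)%E.
  apply: (le_trans H); rewrite !EFinM; apply: lee_pmul => //.
  - by rewrite mule_ge0 ?lee_fin ?(ltW C0)// Lnorm_ge0.
  - exact: Lnorm_ge0.
  - by apply: lee_pmul; rewrite ?lee_fin ?(ltW C0)// ?Lnorm_ge0// upp.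
  - exact: upm.
have pos3 : 0 <= (2 * pi) ^+ 3 * B / (a * T).
  apply: divr_ge0; apply: mulr_ge0 => //; try exact: ltW.
  by apply: exprn_ge0; apply: mulr_ge0 => //; exact: pi_ge0.
have -> : C * U * U = C * ((2 * pi) ^+ 3 * B / (a * T)).
  by rewrite -mulrA -expr2 sqr_sqrtr.
rewrite lee_fin.
have L0 : 0 <= 2 * pi ^+ 2 * expR (- (5 / 2)) * B' * a / T.
  apply: divr_ge0; last exact: ltW.
  apply: mulr_ge0; last exact: ltW.
  apply: mulr_ge0 => //; apply: mulr_ge0; last exact: expR_ge0.
  by apply: mulr_ge0 => //; exact: sqr_ge0.
have R0 : 0 <= C * ((2 * pi) ^+ 3 * B / (a * T)) by apply: mulr_ge0 => //; exact: ltW.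
rewrite -ler_sqr ?nnegrE ?sqrtr_ge0// sqr_sqrtr// => main.
(* Both sides of [main] are multiplied by [a^2 * N^(- 4 s)], which makes the
   right-hand side independent of [N]. *)
rewrite ler_pdivlMr// mulrC.
pose P := N `^ (2 * s * beta - 3 - 4 * s).
have P1 : 1 <= P by rewrite -(powRr0 N); exact: ler_powR.
pose Q := N ^+ 2 * a.
have Q0 : 0 < Q by rewrite mulr_gt0 ?exprn_gt0.
have NQ : N `^ (2 * delta) <= Q `^ (2 * delta).
  apply: ge0_ler_powR; rewrite ?nnegrE ?(ltW N0) ?(ltW Q0)//.
    by rewrite mulr_ge0// ltW.
  rewrite /Q /a -powR_mulrn ?(ltW N0)// -powD -[leLHS](powRr1 (ltW N0)).
  by apply: ler_powR => //; lra.
apply: (@le_trans _ _ (k1 * (Q `^ (2 * delta) * P))).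
  rewrite ler_wpM2l ?(ltW k10)// (le_trans NQ)// -[leLHS]mulr1.
  by rewrite ler_wpM2l ?powR_ge0.
have -> : k1 * (Q `^ (2 * delta) * P) =
  2 * pi ^+ 2 * expR (- (5 / 2)) * B' * a / T * (a ^+ 2 * N `^ (- (4 * s))).
  have Q2 : Q `^ (2 * delta) = Q `^ (2 * (- (1 / 2) + delta)) * Q.
    rewrite -[X in _ = _ * X](powRr1 (ltW Q0)) -powRD; last by rewrite (gt_eqF Q0) implybT.
    by congr (_ `^ _); lra.
  have PE : P = m `^ (2 * s) * N ^- 3 * N `^ (- (4 * s)).
    rewrite /P /m -powRrM -powR_invn ?(ltW N0)// -!powD.
    by congr (_ `^ _); ring.
  have m0 : 0 <= m by exact: le_trans m1.
  rewrite Q2 PE /k1 /B' -/Q (@powRM _ 21 Q)// ?(ltW Q0)// (@powRM _ 3 m)//.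
  rewrite {2}/Q TE.
  move: (powR Q _) (powR m _) (powR N _) => X Y Z.
  move: (powR 21 _) (powR 3 _) (expR _) => x21 x3 e.
  clear -a0 N0; clearbody a.
  by field; rewrite !gt_eqF.
have -> : k2 = (C * ((2 * pi) ^+ 3 * B / (a * T))) ^+ 2 * (a ^+ 2 * N `^ (- (4 * s))).
  have N4 : N `^ (- (4 * s)) = (N `^ (2 * s)) ^- 2.
    by rewrite powRN -powR_mulrn ?powR_ge0// -powRrM; congr (_ `^ _)^-1; lra.
  rewrite N4 /k2 /B; field.
  by rewrite !gt_eqF// powR_gt0.
by rewrite ler_wpM2r// mulr_ge0 ?powR_ge0 ?sqr_ge0.
Qed.

End failure.

Unset Implicit Arguments.

Theorem proposition3p4 (R : realType) (alpha s : R) :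
  0 < alpha -> alpha <= 1 -> s <= s_crit alpha ->
  exists2 delta0 : R, 0 < delta0 &
    forall delta : R, 0 < delta -> delta < delta0 ->
      ~ exists2 C : R, 0 < C &
          forall u v : R * R -> R[i], schwartz u -> schwartz v ->
            (Xnorm (- (1 / 2) + delta) s alpha
               (partial_x (fun z => (u z * v z)%R))
             <= C%:E * Xnorm (1 / 2) s alpha u * Xnorm (1 / 2) s alpha v)%E.
Proof.
move=> alpha0 alpha1 sle; exists (1 / 2); first by lra.
move=> delta d0 d1 [C C0 H].
have [K HK] := bilinear_estimate_bounds_powers alpha0 alpha1 sle d0 d1 C0 H.
have K1 : 1 <= K by have := HK 1 (lexx _); rewrite powR1.
(* The power [N^(2 delta)] is then [K + 1]. *)
pose N := (K + 1) `^ (2 * delta)^-1.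
have N1 : 1 <= N.
  rewrite -(powRr0 (K + 1)); apply: ler_powR; first by lra.
  by rewrite invr_ge0 mulr_ge0 ?ltW.
have := HK N N1.
rewrite /N -powRrM mulVf; last by rewrite mulf_neq0// gt_eqF.
by rewrite powRr1; lra.
Qed.
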